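(* Let $A$ (resp. $A'$) be a closed simple non-maximal $\pi$-symmetric operator of class $(LP)$ in a Pontryagin space $\Pi_\kappa$ (resp. $\Pi'_\kappa$). Let $\mathcal G_1\subseteq\mathcal G_0$ be Hilbert spaces, $\mathcal G=\mathcal G_0\oplus\mathcal G_1$, and let $\Pi=(\mathcal G,\Gamma^B)$ and $\Pi'=(\mathcal G,\Gamma^{B'})$ be $D$-boundary triples for $A^c$ and $A'^c$ respectively, with Weyl functions $M_{\Gamma^B}$ and $M_{\Gamma^{B'}}$. Then for all sufficiently large $R$ the following holds: if $M_{\Gamma^B}(\lambda)=M_{\Gamma^{B'}}(\lambda)$ for all $\lambda$ with $\operatorname{Im}\lambda>R$, then $\Pi'$ is unitarily equivalent to $\Pi$. (That is, the Weyl function on $\{\lambda:\operatorname{Im}\lambda>R\}$ determines a $D$-boundary triple uniquely up to unitary equivalence.)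
   Context: All spaces are complex and separable, inner products linear in the first argument; linear relations are linear subspaces of $X\times Y$, operators are identified with their graphs. $\operatorname{Ker}_\lambda T=\{x:(x,\lambda x)\in T\}$, $\lambda I=\{(x,\lambda x)\}$, $\operatorname{C\,Lin}$ is closed linear span, $\mathcal D_T,\mathcal R_T$ denote domain and range, $\mathbb C_*=\mathbb C\setminus\mathbb R$, $\mathbb C^\pm$ the open half-planes, $\Lambda^*=\{\bar\lambda:\lambda\in\Lambda\}$, $r(T)$ is the set of points of regular type ($\operatorname{Ker}_\lambda T=\{0\}$ and $(T-\lambda I)^{-1}$ bounded on its domain). $\Pi_\kappa$ is a Pontryagin space with $\kappa$ negative squares and indefinite metric $[\cdot,\cdot]$. For a relation $T$ in $\Pi_\kappa$, $T^c=\{(y,x): [u,x]=[v,y]\ \forall (u,v)\in T\}$. $T$ is $\pi$-symmetric if $T\subseteq T^c$ (maximal if it has no proper $\pi$-symmetric extension), and $\pi$-dissipative if $\operatorname{Im}[y,x]\ge0$ for all $(x,y)\in T$. Class $(LP)$: a closed $\pi$-symmetric operator $A$ is in $(P)$ if $\mathcal D_A+\mathcal R_A$ is dense in $\Pi_\kappa$; it is in $(LP)$ if in addition there is a canonical decomposition $\Pi_\kappa=\Pi^-[\oplus]\Pi^+$ in which the negative subspace satisfies $\Pi^-\subseteq\mathcal D_A$. Let $P^-$ be the canonical projection onto $\Pi^-$ and $\|\cdot\|$ the norm induced by the decomposition. For $A\in(LP)$ (with such $\Pi^-$) $\Gamma_A\subseteq\mathbb C_*$ denotes an open set with the following properties: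 $\Gamma_A\supseteq\{\lambda:|\operatorname{Im}\lambda|>t_0\|AP^-\|\}$ for a universal constant $t_0\approx1.84$; $\Gamma_A=-\Gamma_A=\Gamma_{-A}=\Gamma_A^*$; and $\mathbb C^-\cap\Gamma_A\subseteq r(A^\sim)$ for every $\pi$-dissipative extension $A^\sim$ of $A$ (and likewise with $-A$ in place of $A$). $A\in(LP)$ is simple if $\operatorname{C\,Lin}\{\operatorname{Ker}_\lambda A^c:\lambda\in\Gamma_A\}=\Pi_\kappa$. Boundary triples. For a Krein space $(\mathcal H,[\cdot,\cdot])$, $\mathcal H_\Gamma=\mathcal H\oplus\mathcal H$ with $[(x,x'),(y,y')]_\Gamma=\mathrm i[x,y']-\mathrm i[x',y]$. Let $\mathcal G=\mathcal G_0\oplus\mathcal G_1$, $\mathcal G'=\mathcal G_1\oplus\mathcal G_0$. For a closed symmetric $A$ in $\mathcal H$, a boundary triple $\Pi=(\mathcal G,\Gamma^B)$ for the dual pair $(A,A)$ consists of surjective linear operators $\Gamma^B:\mathcal D_{\Gamma^B}\to\mathcal G$, $\Gamma^A:\mathcal D_{\Gamma^A}\to\mathcal G'$ with domains in $\mathcal H_\Gamma$ whose closures both equal $A^c$, satisfying: if $\Gamma^B\hat x=(l_0,l_1)$ and $\Gamma^A\hat y=(h_1,h_0)$ then $[\hat x,\hat y]_\Gamma=\mathrm i\langle l_0,h_0\rangle-\mathrm i\langle l_1,h_1\rangle$ ($\Gamma^A$ is uniquely determined by $\Gamma^B$). Its Weyl family is $M_{\Gamma^B}(\lambda)=\Gamma^B(\lambda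 I\cap\mathcal D_{\Gamma^B})$, a relation from $\mathcal G_0$ to $\mathcal G_1$. If $\mathcal G_1\subseteq\mathcal G_0$ and $\mathcal G_2=\mathcal G_0\ominus\mathcal G_1$, a $D$-boundary triple for $A^c$ is a boundary triple $\Pi=(\mathcal G,\Gamma^B)$ for $(A,A)$ such that $\Gamma^A=E\Gamma^B$, where $E(l_0,l_1)=(E_1l_0,\ \mathrm iE_2l_0+l_1)$ on $\mathcal G$ and $E_1,E_2$ are the orthogonal projections in $\mathcal G_0$ onto $\mathcal G_1,\mathcal G_2$. $\Pi'$ is unitarily equivalent to $\Pi$ if there is a bijective bounded operator $U:\Pi_\kappa\to\Pi'_\kappa$ preserving the indefinite metrics such that $\Gamma^{B'}=\Gamma^B\tilde U^{-1}$, $\tilde U=\operatorname{diag}(U,U)$. Primed objects are defined analogously.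
   Formalization: That Γ^A is determined by Γ^B is read as maximality: Γ^A is the largest relation satisfying Green's identity with Γ^B. Without this, restricting a triple to a smaller dense domain keeps the Weyl function but is not unitarily equivalent, so the claim would fail. *)

(* Defs.v *)
From HB Require Import structures.
From mathcomp Require Import all_boot all_order all_algebra.
From mathcomp Require Import complex.
From mathcomp Require Import all_classical all_reals all_analysis.

Set Implicit Arguments.
Unset Strict Implicit.
Unset Printing Implicit Defensive.

Import Order.TTheory GRing.Theory Num.Theory numFieldNormedType.Exports.

Local Open Scope ring_scope.
Local Open Scope classical_set_scope.

Definition separable (T : topologicalType) : Prop :=
  exists2 D : set T, countable D & dense D.

Section Subspaces.
Context {R : realType}.

Definition linear_subspace (V : lmodType R[i]) (S : set V) : Prop :=
  S 0 /\ forall (a : R[i]) (x y : V), S x -> S y -> S (a *: x + y).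

Definition has_dimension (V : lmodType R[i]) (n : nat) (S : set V) : Prop :=
  exists e : 'I_n -> V,
    S = [set x | exists c : 'I_n -> R[i], x = \sum_i c i *: e i] /\
    forall c : 'I_n -> R[i], \sum_i c i *: e i = 0 -> forall i, c i = 0.

Definition lin_span (V : lmodType R[i]) (S : set V) : set V :=
  [set x | exists (n : nat) (c : 'I_n -> R[i]) (v : 'I_n -> V),
     (forall i, S (v i)) /\ x = \sum_i c i *: v i].

Definition closed_lin_span (V : normedModType R[i]) (S : set V) : set V :=
  closure (lin_span S).

(* The projection onto S parallel to S', when V is their direct sum. *)
Definition proj_along (V : lmodType R[i]) (S S' : set V) (x : V) : V :=
  xget 0 [set y | S y /\ S' (x - y)].

End Subspaces.

Section LinearRelations.
Context {R : realType}.

Definition rel_dom (V W : Type) (T : set (V * W)) : set V := fst @` T.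
Definition rel_ran (V W : Type) (T : set (V * W)) : set W := snd @` T.

Definition single_valued (V W : Type) (T : set (V * W)) : Prop :=
  forall x y y', T (x, y) -> T (x, y') -> y = y'.

Definition linear_operator (V W : lmodType R[i]) (T : set (V * W)) : Prop :=
  linear_subspace (T : set (V * W)%type) /\ single_valued T.

Definition bounded_rel (V W : normedModType R[i]) (T : set (V * W)) : Prop :=
  exists c : R[i], forall x y, T (x, y) -> `|y| <= c * `|x|.

Definition rel_opp (V W : lmodType R[i]) (T : set (V * W)) : set (V * W) :=
  [set p | T (p.1, - p.2)].

Definition rel_shift (V : lmodType R[i]) (T : set (V * V)) (l : R[i]) :
  set (V * V) := [set (p.1, p.2 - l *: p.1) | p in T].

Definition scalar_rel (V : lmodType R[i]) (l : R[i]) : set (V * V) :=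
  [set (x, l *: x) | x in [set: V]].

Definition Ker_at (V : lmodType R[i]) (l : R[i]) (T : set (V * V)) : set V :=
  [set x | T (x, l *: x)].

Definition regular_type (V : normedModType R[i]) (T : set (V * V)) :
  set R[i] :=
  [set l | Ker_at l T = [set 0] /\ bounded_rel ((rel_shift T l)^-1)%relation].

End LinearRelations.

(* An inner product space with inner product [ip] is Hilbert if [ip] induces
   the norm of the complete space carrying it. *)
Definition hilbert_ip (R : realType) (G : completeNormedModType R[i])
    (ip : {dot G for Num.conj}) : Prop :=
  forall x, `|x| ^+ 2 = ip x x.

(* Forms are linear in the first argument and conjugate-linear in the second.
   A Pontryagin space is a complete normed space H with a hermitian form; the
   norm of H only fixes the topology, which is required to be the one given by
   a canonical decomposition. *)
Section Pontryagin.
Context {R : realType} {H : completeNormedModType R[i]}.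
Variable f : {hermitian H for false & Num.conj}.

Definition decomposition_norm (Hm Hp : set H) (x : H) : R :=
  Num.sqrt (complex.Re (f (proj_along Hp Hm x) (proj_along Hp Hm x)
                        - f (proj_along Hm Hp x) (proj_along Hm Hp x))).

(* Equivalence of the norms expresses that (Hm, -f) and (Hp, f) are Hilbert
   spaces, as H is complete. *)
Record canonical_decomposition (k : nat) (Hm Hp : set H) : Prop := {
  cd_subm : linear_subspace Hm;
  cd_subp : linear_subspace Hp;
  cd_dim : has_dimension k Hm;
  cd_sum : forall x, exists xm xp, [/\ Hm xm, Hp xp & x = xm + xp];
  cd_ortho : forall xm xp, Hm xm -> Hp xp -> f xm xp = 0;
  cd_neg : forall x, Hm x -> x != 0 -> f x x < 0;
  cd_pos : forall x, Hp x -> x != 0 -> 0 < f x x;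
  cd_norm : exists c d : R, [/\ 0 < c, 0 < d &
    forall x, (c * decomposition_norm Hm Hp x)%:C%C <= `|x| /\
              `|x| <= (d * decomposition_norm Hm Hp x)%:C%C]
}.

Definition pontryagin_space (k : nat) : Prop :=
  exists Hm Hp, canonical_decomposition k Hm Hp.

Definition rel_adj (T : set (H * H)) : set (H * H) :=
  [set p | forall u v, T (u, v) -> f u p.2 = f v p.1].

Definition pi_symmetric (T : set (H * H)) : Prop :=
  linear_subspace (T : set (H * H)%type) /\ T `<=` rel_adj T.

Definition maximal_pi_symmetric (T : set (H * H)) : Prop :=
  pi_symmetric T /\ forall S, pi_symmetric S -> T `<=` S -> S = T.

Definition pi_dissipative (T : set (H * H)) : Prop :=
  linear_subspace (T : set (H * H)%type) /\
  forall x y, T (x, y) -> 0 <= complex.Im (f y x).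

Record class_P (A : set (H * H)) : Prop := {
  P_closed : closed (A : set (H * H)%type);
  P_operator : linear_operator A;
  P_symmetric : pi_symmetric A;
  P_dense : dense [set x + y | x in rel_dom A & y in rel_ran A]
}.

Definition class_LP (k : nat) (A : set (H * H)) : Prop :=
  class_P A /\
  exists Hm Hp, canonical_decomposition k Hm Hp /\ Hm `<=` rel_dom A.

(* The operator norm of A P^-, P^- the projection onto Hm along Hp, with
   respect to the norm induced by the decomposition. *)
Definition opnorm_AP (Hm Hp : set H) (A : set (H * H)) : R :=
  sup [set decomposition_norm Hm Hp y | y in
    [set y | exists2 x, decomposition_norm Hm Hp x <= 1 &
                        A (proj_along Hm Hp x, y)]].

(* Gamma_{-A} = Gamma_A means that Gamma_A is also admissible for -A; as A and
   -A have the same domain and operator norm, this is [Ga_regular_opp]. *)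
Record Gamma_set (k : nat) (t0 : R) (Hm Hp : set H) (A : set (H * H))
    (Ga : set R[i]) : Prop := {
  Ga_decomposition : canonical_decomposition k Hm Hp;
  Ga_dom : Hm `<=` rel_dom A;
  Ga_open : open (Ga : set R[i]^o);
  Ga_nonreal : forall l, Ga l -> complex.Im l != 0;
  Ga_large : [set l | t0 * opnorm_AP Hm Hp A < `|complex.Im l| ] `<=` Ga;
  Ga_opp : [set - l | l in Ga] = Ga;
  Ga_conj : [set l^* | l in Ga] = Ga;
  Ga_regular : forall At, pi_dissipative At -> A `<=` At ->
    Ga `&` [set l | complex.Im l < 0] `<=` regular_type At;
  Ga_regular_opp : forall At, pi_dissipative At -> rel_opp A `<=` At ->
    Ga `&` [set l | complex.Im l < 0] `<=` regular_type At
}.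

Definition simple_LP (A : set (H * H)) (Ga : set R[i]) : Prop :=
  closed_lin_span (\bigcup_(l in Ga) Ker_at l (rel_adj A)) = [set: H].

Definition form_Gamma (x y : H * H) : R[i] := 'i * f x.1 y.2 - 'i * f x.2 y.1.

End Pontryagin.

(* G0 is a Hilbert space and G1 a closed subspace of it; G = G0 (+) G1 and
   G' = G1 (+) G0 are subspaces of G0 * G0. *)
Section BoundaryTriples.
Context {R : realType} {H G0 : completeNormedModType R[i]}.
Variables (f : {hermitian H for false & Num.conj}) (ip : {dot G0 for Num.conj}).
Variable G1 : set G0.

Definition ortho_compl : set G0 := [set x | forall y, G1 y -> ip x y = 0].

Definition green_identity (x : H * H) (l : G0 * G0) (y : H * H) (h : G0 * G0)
  : Prop :=
  form_Gamma f x y = 'i * ip l.1 h.2 - 'i * ip l.2 h.1.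

(* A boundary triple for (A, A).  The domains of GB and GA are only required to
   be dense in A^c, so GA is determined by GB (through Green's identity and the
   surjectivity of GB) only up to the choice of its domain.  [bt_determined]
   says that GA is the largest relation satisfying Green's identity with GB;
   for closed A, a triple whose operators are defined on all of A^c has this
   property. *)
Record boundary_triple (A : set (H * H)) (GB GA : set ((H * H) * (G0 * G0)))
  : Prop := {
  bt_opB : linear_operator GB;
  bt_opA : linear_operator GA;
  bt_ranB : rel_ran GB = [set l | G1 l.2];
  bt_ranA : rel_ran GA = [set h | G1 h.1];
  bt_domB : closure (rel_dom GB : set (H * H)%type) = rel_adj f A;
  bt_domA : closure (rel_dom GA : set (H * H)%type) = rel_adj f A;
  bt_green : forall x l y h, GB (x, l) -> GA (y, h) -> green_identity x l y h;
  bt_determined : forall y h, G1 h.1 ->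
    (forall x l, GB (x, l) -> green_identity x l y h) -> GA (y, h)
}.

Definition E_map (l : G0 * G0) : G0 * G0 :=
  (proj_along G1 ortho_compl l.1, 'i *: proj_along ortho_compl G1 l.1 + l.2).

Definition D_boundary_triple (A : set (H * H)) (GB : set ((H * H) * (G0 * G0)))
  : Prop :=
  boundary_triple A GB [set (p.1, E_map p.2) | p in GB].

Definition weyl_family (GB : set ((H * H) * (G0 * G0))) (l : R[i]) :
  set (G0 * G0) :=
  [set g | exists2 x, scalar_rel l x & GB (x, g)].

End BoundaryTriples.

Definition unitarily_equivalent (R : realType)
    (H H' G0 : completeNormedModType R[i])
    (f : {hermitian H for false & Num.conj})
    (f' : {hermitian H' for false & Num.conj})
    (GB : set ((H * H) * (G0 * G0))) (GB' : set ((H' * H') * (G0 * G0))) :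
  Prop :=
  exists U : {linear H -> H'},
    [/\ bijective U,
        exists c : R[i], forall x, `|U x| <= c * `|x|,
        forall x y, f' (U x) (U y) = f x y &
        GB' = [set ((U p.1.1, U p.1.2), p.2) | p in GB]].

(* Main.v *)
Require Import Defs.
From HB Require Import structures.
From mathcomp Require Import all_boot all_order all_algebra.
From mathcomp Require Import complex.
From mathcomp Require Import all_classical all_reals all_analysis.
From mathcomp Require Import ring lra.

(** A defect element of [A] at [l] is a pair [(x, l x)] in the adjoint of [A].  For
    defect elements at [l] and [m], with boundary values [(l0, l1)] and [k], and
    with [(h1, h0)] the value [E k] of the partner operator, Green's identity reads
    [(m^* - l) f x y = <l0, h0> - <l1, h1>].  So whenever [l] differs from [m^*], the
    boundary values of two defect elements determine the inner product of the
    defect vectors.  The values attained at [l] form the Weyl family at [l]; if the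
    two Weyl families agree at [l], each defect vector of [A] at [l] has a partner
    for [A'] with the same boundary value, and matching partners preserves the
    forms.  To avoid the excluded pairs of conjugate points, only points of
    [sector r] are used, which contains points of both half-planes but no two
    conjugate ones.

    Agreement in the lower half-plane follows from agreement in the upper one,
    because the Weyl family at [l^*] is expressed by the one at [l]
    ([weyl_conj], [weyl_family_conj_eq]).  This uses that the boundary operators
    are defined on the whole adjoint ([GB_total]) and have kernel [A] ([GB_ker]).

    The matched vectors must be total in both spaces ([defect_total]).  Simplicity
    gives this only when the defect spaces at all points of the set Gamma are
    taken together, and that set need not be connected.  But simplicity also excludes
    nonreal eigenvalues of [A], which in a Pontryagin space makes every nonreal
    point regular ([regular_bound]).  On the orthogonal companion [N] of the defect
    spaces over a small set, the resolvent of [A] can then be continued along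
    segments through each half-plane ([onto_at_half_plane]).  Hence [N] is orthogonal
    to every defect space, and is zero.  For the same reason the bound on the height
    can be any positive number.

    An isometric relation with total domain and range between Pontryagin spaces
    extends to a bounded unitary operator [U] ([unitary_extension]).  Finally [U]
    respects the boundary operators on all of the adjoint, and not only on the
    defect elements: the orthogonal companion of the defect elements over
    [sector r] is [A], the kernel of the boundary operator
    ([defect_orthogonal], [transport]). *)

Set Implicit Arguments.
Unset Strict Implicit.
Unset Printing Implicit Defensive.

Import Order.TTheory GRing.Theory Num.Theory numFieldNormedType.Exports.

Local Open Scope ring_scope.
Local Open Scope classical_set_scope.

Local Notation Re := complex.Re.
Local Notation Im := complex.Im.

(** * Complex scalars and real-valued norms *)

Section RealNorm.
Context {R : realType}.
Implicit Types (a b : R[i]).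

Lemma ReD a b : Re (a + b) = Re a + Re b. Proof. by case: a b => [? ?] [? ?]. Qed.
Lemma ImD a b : Im (a + b) = Im a + Im b. Proof. by case: a b => [? ?] [? ?]. Qed.
Lemma ReN a : Re (- a) = - Re a. Proof. by case: a. Qed.
Lemma ImN a : Im (- a) = - Im a. Proof. by case: a. Qed.
Lemma ReM a b : Re (a * b) = Re a * Re b - Im a * Im b.
Proof. by case: a b => [? ?] [? ?]. Qed.
Lemma ImM a b : Im (a * b) = Re a * Im b + Im a * Re b.
Proof. by case: a b => [? ?] [? ?]. Qed.
Lemma ReJ a : Re (a^*)%C = Re a. Proof. by case: a. Qed.
Lemma ImJ a : Im (a^*)%C = - Im a. Proof. by case: a. Qed.
Definition ReImE := (ReD, ImD, ReN, ImN, ReM, ImM, ReJ, ImJ).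

(** Norms over [R[i]] are elements of [R[i]], whose order is partial; [nrm] is the
    same number seen in [R], where linear arithmetic is available. *)
Definition nrm {W : normedZmodType R[i]} (x : W) : R := Re `|x|.

Section Zmod.
Variable W : normedZmodType R[i].
Implicit Types x y : W.

Lemma normE x : `|x| = (nrm x)%:C%C.
Proof. by rewrite /nrm RRe_real // normr_real. Qed.

Lemma nrm_ge0 x : 0 <= nrm x. Proof. by rewrite -ler0c -normE. Qed.

Lemma nrm0 : nrm (0 : W) = 0. Proof. by rewrite /nrm normr0. Qed.

Lemma nrm_eq0 x : nrm x = 0 -> x = 0.
Proof. by move=> h; apply/eqP; rewrite -normr_eq0 normE h. Qed.

Lemma nrm_gt0 x : x <> 0 -> 0 < nrm x.
Proof. by move=> h; rewrite lt_neqAle nrm_ge0 eq_sym andbT; apply/eqP => /nrm_eq0. Qed.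

Lemma nrmD x y : nrm (x + y) <= nrm x + nrm y.
Proof. by rewrite -lecR rmorphD /= -!normE ler_normD. Qed.

Lemma nrmN x : nrm (- x) = nrm x. Proof. by rewrite /nrm normrN. Qed.

Lemma nrmBC x y : nrm (x - y) = nrm (y - x). Proof. by rewrite /nrm distrC. Qed.

Lemma nrmB x y : nrm (x - y) <= nrm x + nrm y.
Proof. by rewrite (le_trans (nrmD _ _)) // nrmN. Qed.

Lemma nrm_tri y x z : nrm (x - z) <= nrm (x - y) + nrm (y - z).
Proof. by rewrite -(subrKA y); apply: nrmD. Qed.

Lemma nrm_le_sub x y : nrm x <= nrm y + nrm (x - y).
Proof. by rewrite -{1}(subrK y x) addrC nrmD. Qed.
End Zmod.

Lemma nrm_sqr a : nrm a ^+ 2 = Re a ^+ 2 + Im a ^+ 2.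
Proof. by rewrite /nrm normc_def /= sqr_sqrtr // addr_ge0 ?sqr_ge0. Qed.

Lemma nrmM a b : nrm (a * b) = nrm a * nrm b.
Proof. by apply: complexI; rewrite rmorphM /= -!normE normrM. Qed.

Lemma nrmJ a : nrm (a^*)%C = nrm a. Proof. by rewrite /nrm normcJ. Qed.

Lemma nrm_real (t : R) : nrm (t%:C%C : R[i]) = `|t|.
Proof. by rewrite /nrm normc_def /= expr0n addr0 sqrtr_sqr. Qed.

Lemma absRe_le a : `|Re a| <= nrm a.
Proof.
rewrite -ler_sqr ?nnegrE ?nrm_ge0 //.
by rewrite real_normK ?num_real // nrm_sqr lerDl sqr_ge0.
Qed.

Lemma absIm_le a : `|Im a| <= nrm a.
Proof.
rewrite -ler_sqr ?nnegrE ?nrm_ge0 //.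
by rewrite real_normK ?num_real // nrm_sqr lerDr sqr_ge0.
Qed.

Lemma Re_le a : Re a <= nrm a.
Proof. exact: le_trans (ler_norm _) (absRe_le a). Qed.

(** Two points of the same open half-plane are joined by a segment that stays off
    the real axis; [a] and [b] are the imaginary parts of its ends. *)
Lemma segment_avoids0 (a b t : R) : 0 < a * b -> 0 <= t -> t <= 1 ->
  (1 - t) * a + t * b != 0.
Proof.
move=> ab t0 t1; apply/eqP => h.
have a2 : 0 < a ^+ 2.
  rewrite lt_neqAle sqr_ge0 andbT eq_sym sqrf_eq0.
  by apply: contraTneq ab => ->; rewrite mul0r ltxx.
have e : (1 - t) * a ^+ 2 + t * (a * b) = 0.
  by rewrite -[RHS](mulr0 a) -h; ring.
have h1 : 0 <= (1 - t) * a ^+ 2 by rewrite mulr_ge0 ?subr_ge0 // ltW.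
have h2 : 0 <= t * (a * b) by rewrite mulr_ge0 // ltW.
have h3 : t * (a * b) = 0 by lra.
have h4 : (1 - t) * a ^+ 2 = 0 by lra.
move/eqP: h3; rewrite mulf_eq0 (gt_eqF ab) orbF => /eqP t00.
by move/eqP: h4; rewrite t00 subr0 mul1r (gt_eqF a2).
Qed.

Lemma same_sign_near (a b c : R) : 0 < b * c -> `|a - b| < `|b| -> 0 < a * c.
Proof.
move=> bc h; have [b0|b0] := ltP 0 b.
  rewrite pmulr_rgt0 // in bc; rewrite pmulr_lgt0 //.
  by move: h; rewrite (gtr0_norm b0) ltr_norml => /andP[]; lra.
have {}b0 : b < 0.
  by rewrite lt_neqAle b0 andbT; apply: contraTneq bc => ->; rewrite mul0r ltxx.
rewrite nmulr_rgt0 // in bc; rewrite nmulr_lgt0 //.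
by move: h; rewrite (ltr0_norm b0) ltr_norml => /andP[]; lra.
Qed.

Lemma small_eq0 (W : normedZmodType R[i]) (x : W) (K : R) :
  (forall e : R, 0 < e -> nrm x <= K * e) -> x = 0.
Proof.
move=> h; apply: nrm_eq0; apply/eqP; rewrite eq_le nrm_ge0 andbT.
rewrite leNgt; apply/negP => p.
have K1 : 0 < `|K| + 1 by rewrite ltr_wpDl.
have /h : 0 < nrm x / (2 * (`|K| + 1)) by rewrite divr_gt0 ?mulr_gt0.
apply/negP; rewrite -ltNge.
apply: (@le_lt_trans _ _ ((`|K| + 1) * (nrm x / (2 * (`|K| + 1))))).
  apply: ler_wpM2r; first by rewrite divr_ge0 ?mulr_ge0 // nrm_ge0.
  by rewrite (le_trans (ler_norm K)) // lerDl.
have -> : (`|K| + 1) * (nrm x / (2 * (`|K| + 1))) = nrm x / 2.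
  by field; rewrite lt0r_neq0.
by lra.
Qed.

Lemma inv_succ_small (e : R) : 0 < e ->
  exists N : nat, forall n, (N <= n)%N -> n.+1%:R^-1 < e.
Proof.
move=> e0; exists (Num.bound e^-1) => n Nn.
rewrite -(invrK e) ltf_pV2 ?posrE ?invr_gt0 ?ltr0n //.
have /archi_boundP h : 0 <= e^-1 by rewrite invr_ge0 ltW.
by apply: lt_le_trans h _; rewrite ler_nat (leq_trans Nn).
Qed.

Lemma nrmZ (W : normedModType R[i]) a (x : W) : nrm (a *: x) = nrm a * nrm x.
Proof. by apply: complexI; rewrite rmorphM /= -!normE normrZ. Qed.

Lemma gt0_complexE (e : R[i]) : 0 < e -> 0 < Re e /\ e = (Re e)%:C%C.
Proof.
move=> p; have h : e = (Re e)%:C%C by rewrite RRe_real // gtr0_real.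
by split=> //; rewrite -ltcR -h.
Qed.

Lemma closure_approx (W : normedModType R[i]) (S : set W) x :
  closure S x <->
  (forall e : R, 0 < e -> exists2 y, S y & nrm (x - y) < e).
Proof.
split=> [cx e e0|h B].
  have [|y [Sy]] := cx (ball x e%:C%C).
    by apply: nbhsx_ballx; rewrite ltcR.
  by rewrite -ball_normE /= normE ltcR; exists y.
move=> /nbhs_ballP[e /= /gt0_complexE[e0 ee] sB].
have [y Sy xy] := h _ e0; exists y; split=> //; apply: sB.
by rewrite -ball_normE /= ee normE ltcR.
Qed.

Lemma closed_approx (W : normedModType R[i]) (S : set W) :
  closed S <->
  (forall x, (forall e : R, 0 < e -> exists2 y, S y & nrm (x - y) < e) -> S x).
Proof.
split=> [cS x h|h x]; first exact/cS/closure_approx.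
by move/closure_approx; apply: h.
Qed.

Lemma closure_approx2 (W1 W2 : normedModType R[i]) (S : set (W1 * W2)) p :
  closure (S : set (W1 * W2)%type) p <->
  (forall e : R, 0 < e ->
     exists2 q, S q & nrm (p.1 - q.1) < e /\ nrm (p.2 - q.2) < e).
Proof.
split=> [cp e e0|h B].
  have [|q [Sq]] := cp (ball p e%:C%C).
    by apply: nbhsx_ballx; rewrite ltcR.
  move=> [b1 b2]; exists q => //.
  by move: b1 b2; rewrite -!ball_normE /= !normE !ltcR.
move=> /nbhs_ballP[e /= /gt0_complexE[e0 ee] sB].
have [q Sq [p1 p2]] := h _ e0; exists q; split=> //; apply: sB.
by split; rewrite -ball_normE /= ee normE ltcR.
Qed.

Lemma closed_approx2 (W1 W2 : normedModType R[i]) (S : set (W1 * W2)) :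
  closed (S : set (W1 * W2)%type) <->
  (forall p, (forall e : R, 0 < e ->
     exists2 q, S q & nrm (p.1 - q.1) < e /\ nrm (p.2 - q.2) < e) -> S p).
Proof.
split=> [cS p h|h p]; first exact/cS/closure_approx2.
by move/closure_approx2; apply: h.
Qed.

Definition limit_of (W : normedZmodType R[i]) (u : nat -> W) (x : W) :=
  forall e : R, 0 < e -> exists N, forall n, (N <= n)%N -> nrm (u n - x) < e.

Lemma cauchy_limit (V : completeNormedModType R[i]) (u : nat -> V) :
  (forall e : R, 0 < e -> exists N, forall m n, (N <= m)%N -> (N <= n)%N ->
     nrm (u m - u n) < e) ->
  exists x, limit_of u x.
Proof.
move=> h.
have c : cauchy (u @ \oo).
  apply: cauchy_exP => e /gt0_complexE[e0 ee]; have [N hN] := h _ e0.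
  exists (u N); exists N => // n /= Nn.
  by rewrite -ball_normE /= ee normE ltcR; apply: hN.
have /cvg_ex[x ux] : cvg (u @ \oo) by exact: cauchy_cvg.
 exists x => e e0.
have /ux[N _ hN] : nbhs x (ball x e%:C%C) by apply: nbhsx_ballx; rewrite ltcR.
exists N => n /hN; rewrite -ball_normE /= normE ltcR.
by rewrite nrmBC.
Qed.

End RealNorm.

(** * Sesquilinear forms and orthogonal projections *)

Section Subspace.
Context {R : realType}.
Variables (V : lmodType R[i]) (S : set V).
Hypothesis linS : linear_subspace S.

Lemma subspace0 : S 0. Proof. exact: linS.1. Qed.
Lemma subspaceZ a x : S x -> S (a *: x).
Proof. by move=> Sx; rewrite -[_ *: _]addr0; apply: linS.2 => //; exact: subspace0. Qed.
Lemma subspaceD x y : S x -> S y -> S (x + y).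
Proof. by move=> Sx Sy; rewrite -[x]scale1r; apply: linS.2. Qed.
Lemma subspaceB x y : S x -> S y -> S (x - y).
Proof. by move=> Sx Sy; rewrite addrC -scaleN1r; apply: linS.2. Qed.
End Subspace.

Section Forms.
Context {R : realType} {V : normedModType R[i]}.
Implicit Types (g : V -> V -> R[i]) (x y z : V).

Record hermitian_form g : Prop := {
  formP : forall a x y z, g (a *: x + y) z = a * g x z + g y z;
  formC : forall x y, g y x = ((g x y)^*)%C
}.

Record bounded_form g : Prop := {
  bounded_form_hermitian :> hermitian_form g;
  form_bounded : exists2 K : R, 0 <= K &
    forall x y, nrm (g x y) <= K * nrm x * nrm y
}.

Section Hermitian.
Variable g : V -> V -> R[i].
Hypothesis hg : hermitian_form g.

Lemma formDl x y z : g (x + y) z = g x z + g y z.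
Proof. by rewrite -[x]scale1r (formP hg) mul1r scale1r. Qed.
Lemma form0l z : g 0 z = 0.
Proof. by apply: (addrI (g 0 z)); rewrite -formDl !addr0. Qed.
Lemma formZl a x z : g (a *: x) z = a * g x z.
Proof. by rewrite -[_ *: _]addr0 (formP hg) form0l addr0. Qed.
Lemma formNl x z : g (- x) z = - g x z.
Proof. by rewrite -scaleN1r formZl mulN1r. Qed.
Lemma formBl x y z : g (x - y) z = g x z - g y z.
Proof. by rewrite formDl formNl. Qed.
Lemma formDr x y z : g z (x + y) = g z x + g z y.
Proof. by rewrite (formC hg) formDl rmorphD /= -!(formC hg). Qed.
Lemma form0r z : g z 0 = 0.
Proof. by rewrite (formC hg) form0l rmorph0. Qed.
Lemma formZr a x z : g z (a *: x) = (a^*)%C * g z x.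
Proof. by rewrite (formC hg) formZl rmorphM /= -(formC hg). Qed.
Lemma formNr x z : g z (- x) = - g z x.
Proof. by rewrite (formC hg) formNl rmorphN /= -(formC hg). Qed.
Lemma formBr x y z : g z (x - y) = g z x - g z y.
Proof. by rewrite formDr formNr. Qed.
Lemma form_diag_real x : Im (g x x) = 0.
Proof.
have := formC hg x x; case: (g x x) => a b [] /= h.
by apply/eqP; rewrite -eqNr -h.
Qed.
Lemma form_eq0_sym x y : g x y = 0 -> g y x = 0.
Proof. by move=> h; rewrite (formC hg) h rmorph0. Qed.

(** The effect on [g x x] of removing from [x] a multiple of its component along
    [y]; both the Cauchy-Schwarz inequality and the variational argument behind
    the projection theorem come from a choice of [t]. *)
Lemma form_expand x y (t : R) :
  Re (g (x - (t%:C%C * g x y) *: y) (x - (t%:C%C * g x y) *: y)) =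
  Re (g x x) - (2 * t - t ^+ 2 * Re (g y y)) * nrm (g x y) ^+ 2.
Proof.
rewrite (formBl) !(formBr) !(formZl) !(formZr) nrm_sqr (formC hg x y).
have := form_diag_real y.
move: (g x x) (g x y) (g y y) => [a a'] [b b'] [c c'] /= ->; ring.
Qed.

Lemma form_cauchy_schwarz : (forall x, 0 <= Re (g x x)) ->
  forall x y, nrm (g x y) ^+ 2 <= Re (g x x) * Re (g y y).
Proof.
move=> g0 x y; have h t := g0 (x - (t%:C%C * g x y) *: y).
have {}h t : (2 * t - t ^+ 2 * Re (g y y)) * nrm (g x y) ^+ 2 <= Re (g x x).
  by rewrite -subr_ge0 -form_expand.
move: h (g0 x) (g0 y) (sqr_ge0 (nrm (g x y))).
move: (Re (g x x)) (Re (g y y)) (_ ^+ 2) => p q a h p0 q0 a0.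
have [q1|q1] := ltP 0 q.
  have := h q^-1; have -> : 2 * q^-1 - q^-1 ^+ 2 * q = q^-1.
    by field; rewrite lt0r_neq0.
  by rewrite mulrC ler_pdivrMr.
have {q1}q1 : q = 0 by apply/eqP; rewrite eq_le q0 q1.
rewrite q1 mulr0 leNgt; apply/negP => a1.
have := h ((p + 1) / (2 * a)); rewrite q1 mulr0 subr0.
have -> : 2 * ((p + 1) / (2 * a)) * a = p + 1.
  by field; rewrite lt0r_neq0.
lra.
Qed.
End Hermitian.

Variable g : V -> V -> R[i].
Hypothesis hg : bounded_form g.

Lemma form_near x x' y K (e : R) : (forall x y, nrm (g x y) <= K * nrm x * nrm y) ->
  0 <= K -> nrm (x - x') < e -> nrm (g x y - g x' y) <= K * nrm y * e.
Proof.
move=> hK K0 /ltW xe; rewrite -(formBl hg) (le_trans (hK _ _)) //.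
by rewrite mulrAC ler_wpM2l // mulr_ge0 // nrm_ge0.
Qed.

(** Boundedness makes orthogonality to a fixed vector pass to the closure. *)
Lemma form_closure0 y (S : set V) x : (forall s, S s -> g s y = 0) ->
  (forall e : R, 0 < e -> exists2 s, S s & nrm (x - s) < e) -> g x y = 0.
Proof.
move=> S0 h; have [K K0 hK] := form_bounded hg.
apply: (@small_eq0 _ _ _ (K * nrm y)) => e e0; have [s Ss xs] := h e e0.
by rewrite -[g x y]subr0 -(S0 s Ss); apply: form_near.
Qed.
End Forms.

Section Hilbert.
Context {R : realType} {V : completeNormedModType R[i]}.
Implicit Types (g : V -> V -> R[i]).

(** Together with [bounded_form] this says that [g] is an inner product whose norm
    is equivalent to the given one, so that [V] is a Hilbert space for [g]. *)
Definition coercive g := exists2 c : R, 0 < c &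
  forall x, c * nrm x ^+ 2 <= Re (g x x).

Variable g : V -> V -> R[i].
Hypothesis hg : bounded_form g.
Hypothesis cg : coercive g.

Lemma coercive_ge0 x : 0 <= Re (g x x).
Proof.
have [c c0 h] := cg; apply: le_trans (h x).
by rewrite mulr_ge0 ?sqr_ge0 // ltW.
Qed.

Lemma coercive_eq0 x : g x x = 0 -> x = 0.
Proof.
move=> g0; have [c c0 /(_ x)] := cg; rewrite g0 pmulr_rle0 // => h.
apply: nrm_eq0; apply/eqP; rewrite -sqrf_eq0 eq_le h; exact: sqr_ge0.
Qed.

(** If [g x x] is within [d] of its infimum along [x + C m], then [x] is almost
    orthogonal to [m]: otherwise moving along [m] would go below the infimum. *)
Lemma near_minimal x m (D d : R) : (forall t, D <= Re (g (x - t *: m) (x - t *: m))) ->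
  Re (g x x) <= D + d -> nrm (g x m) ^+ 2 <= d * (Re (g m m) + 1).
Proof.
move=> Dmin xd; set q := Re (g m m); have q0 : 0 <= q := coercive_ge0 m.
have q1 : 0 < q + 1 by rewrite ltr_wpDl.
(* the optimal coefficient is [g x m / q]; adding 1 avoids dividing by 0 *)
have := Dmin ((q + 1)^-1%:C%C * g x m).
rewrite (form_expand hg) -/q => h.
have e : 2 * (q + 1)^-1 - (q + 1)^-1 ^+ 2 * q = ((q + 2) / (q + 1)) / (q + 1).
  by field; rewrite lt0r_neq0.
rewrite e in h; have {h} : (q + 2) / (q + 1) / (q + 1) * nrm (g x m) ^+ 2 <= d.
  by move: h xd; lra.
have n0 := sqr_ge0 (nrm (g x m)).
move=> h; rewrite -ler_pdivrMr //; apply: le_trans h.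
have -> : (q + 2) / (q + 1) = 1 + (q + 1)^-1 by field; rewrite lt0r_neq0.
have s0 : 0 <= (q + 1)^-1 by rewrite invr_ge0 ltW.
rewrite mulrC ler_wpM2r // -[X in X <= _]mul1r ler_wpM2r //; lra.
Qed.

(** A minimizing sequence is Cauchy by the parallelogram law, and its members
    are asymptotically orthogonal to [M] by [near_minimal]. *)
Lemma projection_exists (M : set V) z : linear_subspace M -> closed M ->
  exists2 m, M m & forall y, M y -> g (z - m) y = 0.
Proof.
move=> linM cM; have [c c0 hc] := cg.
pose E := [set Re (g (z - m) (z - m)) | m in M].
have E0 : E !=set0 by exists (Re (g (z - 0) (z - 0))), 0 => //; exact: subspace0.
have lE : lbound E 0 by move=> _ [m _ <-]; apply: coercive_ge0.
have hE : has_inf E by split=> //; exists 0.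
pose D := inf E.
have DE m : M m -> D <= Re (g (z - m) (z - m)).
  by move=> Mm; apply: ge_inf; [exists 0|exists m].
have ex (d : R) : 0 < d -> exists m, M m /\ Re (g (z - m) (z - m)) < D + d.
  move=> d0; have [_ [m Mm <-] h] := inf_adherent d0 hE.
  by exists m.
have d0 n : 0 < n.+1%:R^-1 :> R by rewrite invr_gt0 ltr0n.
pose u n := projT1 (cid (ex _ (d0 n))).
have uM n : M (u n) by have [] := projT2 (cid (ex _ (d0 n))).
have uD n : Re (g (z - u n) (z - u n)) < D + n.+1%:R^-1.
  by have [] := projT2 (cid (ex _ (d0 n))).
have par m n : c * nrm (u m - u n) ^+ 2 <= 2 * m.+1%:R^-1 + 2 * n.+1%:R^-1.
  apply: le_trans (hc _) _.
  have Mh : M (2^-1 *: (u m + u n)) by apply: (subspaceZ linM); apply: (subspaceD linM).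
  have := DE _ Mh; have := uD m; have := uD n.
  have -> : u m - u n = (z - u n) - (z - u m) by rewrite opprB [RHS]addrC subrKA.
  have -> : z - 2^-1 *: (u m + u n) = 2^-1 *: ((z - u n) + (z - u m)).
    rewrite addrACA -opprD [RHS]scalerDr scalerN (addrC (u n)); congr (_ - _).
    by rewrite -mulr2n -[z *+ 2]scaler_nat scalerA mulVf ?scale1r // pnatr_eq0.
  move: (z - u n) (z - u m) => x y.
  have -> : Re (g (2^-1 *: (x + y)) (2^-1 *: (x + y))) = Re (g (x + y) (x + y)) / 4.
    have h2 : 2^-1 = (2^-1 : R)%:C%C :> R[i] by rewrite fmorphV rmorph_nat.
    rewrite (formZl hg) (formZr hg) h2 conjc_real !ReM /= ?(mul0r, subr0).
    by field.
  rewrite (formBl hg) !(formBr hg) (formDl hg) !(formDr hg) !ReImE.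
  move: n.+1%:R^-1 m.+1%:R^-1 (Re (g x x)) (Re (g x y)) (Re (g y x)) (Re (g y y)).
  move=> a b c1 d e f; lra.
have [|m um] := @cauchy_limit _ _ u.
  move=> e e0; have ce : 0 < c * e ^+ 2 / 4 by rewrite divr_gt0 // mulr_gt0 // exprn_gt0.
  have [N hN] := inv_succ_small ce; exists N => m n Nm Nn.
  rewrite -ltr_sqr ?nnegrE ?nrm_ge0 ?ltW // -(ltr_pM2l c0).
  apply: le_lt_trans (par _ _) _; have := hN _ Nm; have := hN _ Nn.
  move: m.+1%:R^-1 n.+1%:R^-1 (c * e ^+ 2) => a b q; lra.
have Mm : M m.
  apply: (proj1 (closed_approx M) cM) => e e0; have [N hN] := um _ e0.
  by exists (u N) => //; rewrite nrmBC; apply: hN.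
exists m => // y My; have [K K0 hK] := form_bounded hg.
apply: (@small_eq0 _ _ _ (K * nrm y + 1)) => e e0.
set q := Re (g y y) + 1; have q1 : 0 < q by rewrite ltr_wpDl // coercive_ge0.
have [N1 h1] := um _ e0.
have [N2 h2] := inv_succ_small (divr_gt0 (exprn_gt0 2 e0) q1).
pose n := maxn N1 N2.
have nn : nrm (g (z - u n) y) <= e.
  rewrite -ler_sqr ?nnegrE ?nrm_ge0 ?(ltW e0) //.
  apply: le_trans (@near_minimal (z - u n) y D n.+1%:R^-1 _ (ltW (uD n))) _.
    by move=> t; rewrite -addrA -opprD; apply: DE; apply: (subspaceD linM) => //; apply: (subspaceZ linM).
  by rewrite -ler_pdivlMr // ltW // h2 // leq_maxr.
apply: le_trans (nrm_le_sub _ (g (z - u n) y)) _.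
rewrite mulrDl mul1r addrC lerD //; apply: form_near => //.
have -> : z - m - (z - u n) = u n - m by rewrite opprB [LHS]addrC subrKA.
by apply: h1; rewrite leq_maxl.
Qed.

(** [F] vanishes on its closed kernel, so it is a multiple of the inner product
    with a vector orthogonal to that kernel. *)
Lemma riesz (F : V -> R[i]) (K : R) :
  (forall a x y, F (a *: x + y) = a * F x + F y) ->
  0 <= K -> (forall x, nrm (F x) <= K * nrm x) ->
  exists h, forall x, F x = g x h.
Proof.
move=> FP K0 FK.
have F0 : F 0 = 0 by apply: (addrI (F 0)); rewrite -{1}[F 0]mul1r -FP scaler0 !addr0.
have FZ a x : F (a *: x) = a * F x by rewrite -[_ *: _]addr0 FP F0 addr0.
have FB x y : F (x - y) = F x - F y by rewrite addrC -scaleN1r FP mulN1r addrC.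
pose M := [set x | F x = 0].
have linM : linear_subspace M.
  by split=> //= a x y /= hx hy; rewrite /M /= FP hx hy mulr0 addr0.
have cM : closed M.
  apply/closed_approx => x h; apply: (@small_eq0 _ _ _ K) => e e0.
  have [y My /ltW xy] := h e e0.
  by rewrite -[F x]subr0 -[X in _ - X]My -FB (le_trans (FK _)) // ler_wpM2l.
have [[z Fz]|] := pselect (exists z, F z <> 0); last first.
  by move=> /forallNP h; exists 0 => x; rewrite (form0r hg); apply: contrapT (h x).
have [m Mm wM] := projection_exists z linM cM.
set w := z - m in wM.
have Fw : F w <> 0 by rewrite /w FB [F m]Mm subr0.
have gw : g w w <> 0 by move=> /coercive_eq0 w0; apply: Fw; rewrite w0.
exists (((F w / g w w)^*)%C *: w) => x.
have h : g (x - (F x / F w) *: w) w = 0.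
  apply: (form_eq0_sym hg); apply: wM.
  by rewrite /M /= FB FZ divfK ?subrr //; exact/eqP.
rewrite (formZr hg) conjcK; move: h; rewrite (formBl hg) (formZl hg).
move/eqP; rewrite subr_eq0 => /eqP ->.
by field; apply/andP; split; apply/eqP.
Qed.

End Hilbert.

(** * Pontryagin spaces *)

Section DirectSum.
Context {R : realType}.
Variables (V : lmodType R[i]) (S S' : set V).
Hypotheses (linS : linear_subspace S) (linS' : linear_subspace S').
Hypothesis disj : forall x, S x -> S' x -> x = 0.

Lemma proj_alongE x y : S x -> S' y -> proj_along S S' (x + y) = x.
Proof.
move=> Sx Sy; rewrite /proj_along; case: xgetP => [z _ [/= Sz]|/(_ x) /= []].
  move=> h; apply/eqP; rewrite -subr_eq0; apply/eqP/disj.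
    exact: (subspaceB linS).
  have -> : z - x = y - (x + y - z) by rewrite opprB opprD addrCA [y + _]addrCA subrr addr0.
  exact: (subspaceB linS').
by split=> //; rewrite addrC addKr.
Qed.
End DirectSum.

Section Pontryagin.
Context {R : realType} {V : completeNormedModType R[i]}.

(** What the proof uses of a Pontryagin space.  [pontryagin_gram] is the fundamental
    symmetry [J], which turns [f] into a Hilbert space inner product [g];
    [pontryagin_index] says that [f] is uniformly positive on the common kernel
    of finitely many continuous functionals, the [f ^~ (e i)] with [e] a basis of
    the negative subspace. *)
Record pontryagin_form (f : V -> V -> R[i]) : Prop := {
  pontryagin_bounded :> bounded_form f;
  pontryagin_gram : exists g J, [/\ bounded_form g, coercive g &
    forall x y, f x (J y) = g x y];
  pontryagin_index : exists (k : nat) (e : 'I_k -> V), exists2 c : R, 0 < c &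
    forall x, (forall i, f x (e i) = 0) -> c * nrm x ^+ 2 <= Re (f x x)
}.

Lemma hermitian_formP (f : {hermitian V for false & Num.conj}) : hermitian_form f.
Proof.
split=> [a x y z|x y]; first by rewrite linearPl.
by rewrite hermC expr0 mul1r.
Qed.

(** With [m] and [p] the projections onto the negative and positive subspaces,
    [J = p - m] and [g x y = f (p x) (p y) - f (m x) (m y)].  The norm of [g] is
    the norm of the decomposition, and both [f] and [g] are controlled by it
    through the Cauchy-Schwarz inequality because [f x y = g x (J y)]. *)
Lemma canonical_pontryagin k (f : {hermitian V for false & Num.conj}) Hm Hp :
  canonical_decomposition f k Hm Hp -> pontryagin_form f.
Proof.
case=> linM linP [e [HmE e_free]] sum ortho neg pos [c [d [c0 d0 hcd]]].
have hf := hermitian_formP f.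
have disj x : Hm x -> Hp x -> x = 0.
  move=> mx px; apply/eqP; apply/negP => /negP x0.
  by have := neg _ mx x0; rewrite ortho // ltxx.
pose m := proj_along Hm Hp; pose p := proj_along Hp Hm.
have mE a b : Hm a -> Hp b -> m (a + b) = a.
  exact: (proj_alongE linM linP disj).
have pE a b : Hm a -> Hp b -> p (a + b) = b.
  by move=> ma pb; rewrite addrC; apply: (proj_alongE linP linM) => // x px mx; apply: disj.
have dec x : [/\ Hm (m x), Hp (p x) & m x + p x = x].
  by have [a [b [ma pb ->]]] := sum x; rewrite mE // pE.
have Mm x : Hm (m x) by case: (dec x).
have Pp x : Hp (p x) by case: (dec x).
have lin a x y : m (a *: x + y) = a *: m x + m y /\ p (a *: x + y) = a *: p x + p y.
  have -> : a *: x + y = (a *: m x + m y) + (a *: p x + p y).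
    by rewrite addrACA -scalerDr; case: (dec x) => _ _ ->; case: (dec y) => _ _ ->.
  have h1 : Hm (a *: m x + m y) by apply: linM.2.
  have h2 : Hp (a *: p x + p y) by apply: linP.2.
  by rewrite mE ?pE.
have mJ x : m (p x - m x) = - m x.
  by rewrite addrC mE // -scaleN1r; apply: (subspaceZ linM).
have pJ x : p (p x - m x) = p x.
  by rewrite addrC pE // -scaleN1r; apply: (subspaceZ linM).
pose g x y := f (p x) (p y) - f (m x) (m y).
have hg : hermitian_form g.
  split=> [a x y z|x y]; rewrite /g.
    have [-> ->] := lin a x y; rewrite !(formP hf); ring.
  by rewrite rmorphB /= -!(formC hf).
have fE x y : f x y = f (p x) (p y) + f (m x) (m y).
  have [_ _ e1] := dec x; have [_ _ e2] := dec y.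
  have -> : f x y = f (m x + p x) (m y + p y) by rewrite e1 e2.
  rewrite (formDl hf) !(formDr hf) (ortho _ _ (Mm x) (Pp y)).
  by rewrite (form_eq0_sym hf (ortho _ _ (Mm y) (Pp x))) addr0 add0r addrC.
have fJ x y : f x (p y - m y) = g x y by rewrite fE pJ mJ (formNr hf).
have gJ x y : g x (p y - m y) = f x y by rewrite /g pJ mJ (formNr hf) opprK -fE.
have gJJ x : g (p x - m x) (p x - m x) = g x x.
  by rewrite gJ fE pJ mJ (formNl hf) /g.
have npos x : 0 <= Re (g x x).
  have h1 : 0 <= Re (f (p x) (p x)).
    have [->|p0] := eqVneq (p x) 0; first by rewrite (form0l hf).
    by have := pos _ (Pp x) p0; rewrite ltcE => /andP[_ /ltW].
  have h2 : Re (f (m x) (m x)) <= 0.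
    have [->|m0] := eqVneq (m x) 0; first by rewrite (form0l hf).
    by have := neg _ (Mm x) m0; rewrite ltcE => /andP[_ /ltW].
  by rewrite ReD ReN subr_ge0 (le_trans h2).
have dnE x : decomposition_norm f Hm Hp x ^+ 2 = Re (g x x).
  by rewrite /decomposition_norm sqr_sqrtr //; apply: npos.
have dn0 x : 0 <= decomposition_norm f Hm Hp x by apply: sqrtr_ge0.
have lo x : c * decomposition_norm f Hm Hp x <= nrm x.
  by move: (proj1 (hcd x)); rewrite normE lecR.
have hi x : nrm x <= d * decomposition_norm f Hm Hp x.
  by move: (proj2 (hcd x)); rewrite normE lecR.
have gco x : (d ^+ 2)^-1 * nrm x ^+ 2 <= Re (g x x).
  rewrite mulrC ler_pdivrMr ?exprn_gt0 // -dnE mulrC -exprMn ler_sqr //.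
    by rewrite nnegrE nrm_ge0.
  by rewrite nnegrE mulr_ge0 // ltW.
have gbd x y : nrm (g x y) <= (c ^+ 2)^-1 * nrm x * nrm y.
  rewrite -ler_sqr ?nnegrE ?nrm_ge0 //; last first.
    by rewrite !mulr_ge0 ?nrm_ge0 // invr_ge0 sqr_ge0.
  apply: le_trans (form_cauchy_schwarz hg npos x y) _.
  have -> : ((c ^+ 2)^-1 * nrm x * nrm y) ^+ 2 = (nrm x / c) ^+ 2 * (nrm y / c) ^+ 2.
    by field; rewrite lt0r_neq0.
  rewrite -!dnE; apply: ler_pM; rewrite ?sqr_ge0 // ler_sqr ?nnegrE ?divr_ge0 ?nrm_ge0 ?(ltW c0) //.
    by rewrite ler_pdivlMr // mulrC.
  by rewrite ler_pdivlMr // mulrC.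
have ci : 0 <= (c ^+ 2)^-1 by rewrite invr_ge0 sqr_ge0.
have nJ x : nrm (p x - m x) <= d / c * nrm x.
  apply: le_trans (hi _) _; rewrite -mulrA ler_pM2l // mulrC ler_pdivlMr // mulrC.
  apply: le_trans (lo x); rewrite ler_pM2l //.
  by rewrite -ler_sqr ?nnegrE // !dnE gJJ.
split.
- split=> //; exists ((c ^+ 2)^-1 * (d / c)).
    by rewrite mulr_ge0 // divr_ge0 // ltW.
  move=> x y; rewrite -gJ; apply: le_trans (gbd _ _) _.
  have -> : (c ^+ 2)^-1 * (d / c) * nrm x * nrm y = (c ^+ 2)^-1 * nrm x * (d / c * nrm y).
    by ring.
  by rewrite ler_wpM2l // mulr_ge0 ?nrm_ge0.
- exists g, (fun y => p y - m y); split=> //.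
    by split=> //; exists (c ^+ 2)^-1.
  by exists (d ^+ 2)^-1 => //; rewrite invr_gt0 exprn_gt0.
- exists k, e, (d ^+ 2)^-1; first by rewrite invr_gt0 exprn_gt0.
  move=> x ex; apply: le_trans (gco x) _.
  have fm : f x (m x) = 0.
    have := Mm x; rewrite {1}HmE => -[a ->].
    by rewrite linear_sumr big1 // => i _; apply: etrans (formZr hf _ _ _) _; rewrite ex mulr0.
  have m0 : m x = 0.
    apply/eqP; apply/negP => /negP n0; have := neg _ (Mm x) n0.
    have [_ _ e1] := dec x; move: fm; rewrite -{1}e1 (formDl hf).
    by rewrite (form_eq0_sym hf (ortho _ _ (Mm x) (Pp x))) addr0 => ->; rewrite ltxx.
  have [_ _] := dec x; rewrite /g m0 add0r => ->.
  by rewrite (form0l hf) subr0.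
Qed.

Variable f : V -> V -> R[i].
Hypothesis hf : pontryagin_form f.

(** A closed subspace is its own double orthogonal companion: [J] carries the
    [g]-orthogonal complement to the [f]-orthogonal one. *)
Lemma separation (M : set V) z : linear_subspace M -> closed M -> ~ M z ->
  exists2 y, forall m, M m -> f m y = 0 & f z y <> 0.
Proof.
move=> linM cM nMz; have [g [J [hg cg fJ]]] := pontryagin_gram hf.
have [m Mm wM] := projection_exists hg cg z linM cM.
exists (J (z - m)) => [m' Mm'|]; rewrite fJ.
  by apply: (form_eq0_sym hg); apply: wM.
rewrite -{1}(subrK m z) (formDl hg) (form_eq0_sym hg (wM _ Mm)) addr0.
move=> /(coercive_eq0 cg)/eqP; rewrite subr_eq0 => /eqP zm.
by apply: nMz; rewrite zm.
Qed.

Lemma nondegenerate x : (forall y, f x y = 0) -> x = 0.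
Proof.
move=> h; apply: contrapT => x0.
have [y _] : exists2 y, forall m, [set (0 : V)] m -> f m y = 0 & f x y <> 0.
  apply: separation => //.
    by split=> // a u v -> ->; rewrite scaler0 addr0.
  apply/closed_approx => u h0; apply: (@small_eq0 _ _ _ 1) => e e0.
  by have [v -> /ltW] := h0 e e0; rewrite subr0 mul1r.
by rewrite h.
Qed.
End Pontryagin.

(** * Closed relations bounded below *)

Section ClosedRelations.
Context {R : realType} {V : completeNormedModType R[i]} {W : normedModType R[i]}.
Implicit Types (T : set (V * W)).

(** A Cauchy sequence of second components has a Cauchy sequence of first components,
    and the limit pair stays in the closed relation. *)
Lemma closed_range T (C : R) : linear_subspace (T : set (V * W)%type) ->
  closed (T : set (V * W)%type) ->
  0 <= C -> (forall x y, T (x, y) -> nrm x <= C * nrm y) ->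
  closed [set y | exists x, T (x, y)].
Proof.
move=> linT /closed_approx2 cT C0 hC; apply/closed_approx => y hy.
have d0 n : 0 < n.+1%:R^-1 :> R by rewrite invr_gt0 ltr0n.
have ex n : exists p, T p /\ nrm (y - p.2) < n.+1%:R^-1.
  by have [y' [x Tx] h] := hy _ (d0 n); exists (x, y').
pose p n := projT1 (cid (ex n)).
have pT n : T (p n) by have [] := projT2 (cid (ex n)).
have pd n : nrm (y - (p n).2) < n.+1%:R^-1 by have [] := projT2 (cid (ex n)).
have dif m n : nrm ((p m).1 - (p n).1) <= C * (m.+1%:R^-1 + n.+1%:R^-1).
  have /hC h : T ((p m).1 - (p n).1, (p m).2 - (p n).2).
    have -> : ((p m).1 - (p n).1, (p m).2 - (p n).2) = (p m - p n : (V * W)%type) by [].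
    exact: (subspaceB linT).
  apply: le_trans h _; rewrite ler_wpM2l //.
  apply: le_trans (nrm_tri y _ _) _; rewrite nrmBC.
  by apply: lerD; apply: ltW.
have [|x px] := @cauchy_limit _ _ (fun n => (p n).1).
  move=> e e0; have [|N hN] := @inv_succ_small _ (e / (2 * (C + 1))).
    by rewrite divr_gt0 // mulr_gt0 // ltr_wpDl.
  exists N => m n /hN hm /hN hn; apply: le_lt_trans (dif _ _) _.
  have C1 : 0 < C + 1 by rewrite ltr_wpDl.
  apply: (@lt_le_trans _ _ ((C + 1) * (m.+1%:R^-1 + n.+1%:R^-1))).
    by rewrite ltr_pM2r ?ltrDl // addr_gt0.
  have -> : e = (C + 1) * (e / (2 * (C + 1)) + e / (2 * (C + 1))).
    by field; rewrite lt0r_neq0.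
  by rewrite ler_pM2l // lerD // ltW.
exists x; apply: cT => e e0.
have [N1 h1] := px _ e0; have [N2 h2] := inv_succ_small e0.
exists (p (maxn N1 N2)) => //=; split.
  by rewrite nrmBC; apply: h1; rewrite leq_maxl.
by apply: lt_trans (pd _) _; apply: h2; rewrite leq_maxr.
Qed.

Lemma closed_separated (S : set W) w : closed S -> ~ S w ->
  exists2 d : R, 0 < d & forall y, S y -> d <= nrm (w - y).
Proof.
move=> /closed_approx cS nS; apply: contrapT => h; apply: nS; apply: cS => e e0.
apply: contrapT => h'; apply: h; exists e => // y Sy.
by rewrite leNgt; apply/negP => yw; apply: h'; exists y.
Qed.

Variable f : V -> V -> R[i].
Hypothesis hf : bounded_form f.

Lemma restrict_kernel T (e : V) : linear_subspace (T : set (V * W)%type) ->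
  closed (T : set (V * W)%type) ->
  let T' := [set p | T p /\ f p.1 e = 0] in
  linear_subspace (T' : set (V * W)%type) /\ closed (T' : set (V * W)%type).
Proof.
move=> linT /closed_approx2 cT; split.
  split=> [|b x y [Tx fx] [Ty fy]].
    by split; [exact: (subspace0 linT)|exact: (form0l hf)].
  split; first exact: linT.2.
  by rewrite /= (formP hf) fx fy mulr0 addr0.
apply/closed_approx2 => p h; split.
  by apply: cT => d d0; have [q [Tq _] ?] := h d d0; exists q.
apply: (form_closure0 hf (S := [set s | f s e = 0])) => // d d0.
by have [q [_ fq] [? _]] := h d d0; exists q.1.
Qed.

(** Suppose [T] is bounded below on the kernel [T'] of one functional, and [(v, w)]
    in [T] is outside it.  The range of [T'] is closed and misses [w], as [T] is
    injective; so [w] has positive distance [d] from it, and this bounds the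
    coefficient of [(v, w)] in an element of [T] by the second component. *)
Lemma bounded_below_codim1 T (e : V) : linear_subspace (T : set (V * W)%type) ->
  closed (T : set (V * W)%type) -> (forall x, T (x, 0) -> x = 0) ->
  (exists2 C : R, 0 <= C &
     forall x y, T (x, y) -> f x e = 0 -> nrm x <= C * nrm y) ->
  exists2 C : R, 0 <= C & forall x y, T (x, y) -> nrm x <= C * nrm y.
Proof.
move=> linT cT injT [C C0 hC].
have TB a x y x' y' : T (x, y) -> T (x', y') -> T (x - a *: x', y - a *: y').
  move=> h h'.
  have -> : (x - a *: x', y - a *: y') = ((x, y) - a *: (x', y') : (V * W)%type) by [].
  by apply: (subspaceB linT) => //; apply: (subspaceZ linT).
have [[[v0 w0] [T0 /= fv0]]|h] := pselect (exists p, T p /\ f p.1 e <> 0); last first.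
  exists C => // x y Txy; apply: hC => //; apply: contrapT => fx.
  by apply: h; exists (x, y).
pose a := (f v0 e)^-1; pose v := a *: v0; pose w := a *: w0.
have Tv : T (v, w).
  have -> : (v, w) = (a *: (v0, w0) : (V * W)%type) by [].
  exact: (subspaceZ linT).
have fv : f v e = 1 by rewrite (formZl hf) mulVf //; apply/eqP.
pose T0' := [set p : V * W | T p /\ f p.1 e = 0].
have cl : closed [set y | exists x, T0' (x, y)].
  have [linT' cT'] := restrict_kernel e linT cT.
  by apply: (@closed_range _ C) => // x y []; apply: hC.
have nw : ~ [set y | exists x, T0' (x, y)] w.
  move=> [d [Td /= fd]].
  have /injT : T (v - 1 *: d, 0) by rewrite -(subrr w) -{2}[w]scale1r; apply: TB.
  move/eqP; rewrite scale1r subr_eq0 => /eqP vd.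
  by move: fv; rewrite vd fd => /eqP; rewrite eq_sym oner_eq0.
have [d d0 hd] := closed_separated cl nw.
exists (C + (C * nrm w + nrm v) / d).
  by rewrite addr_ge0 // divr_ge0 ?(ltW d0) // addr_ge0 ?mulr_ge0 ?nrm_ge0.
move=> x y Txy; pose c := f x e.
have T1 : T0' (x - c *: v, y - c *: w).
  by split; [apply: TB|rewrite /= (formBl hf) (formZl hf) fv mulr1 subrr].
have cy : nrm c * d <= nrm y.
  have [->|c0] := eqVneq c 0; first by rewrite nrm0 mul0r nrm_ge0.
  have : T0' (- c^-1 *: (x - c *: v), - c^-1 *: (y - c *: w)).
    have -> : (- c^-1 *: (x - c *: v), - c^-1 *: (y - c *: w))
      = (- c^-1 *: (x - c *: v, y - c *: w) : (V * W)%type) by [].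
    split; first exact: (subspaceZ linT) T1.1.
    by rewrite /= (formZl hf) T1.2 mulr0.
  move=> h; have {h} /hd : [set y | exists x, T0' (x, y)] (- c^-1 *: (y - c *: w)).
    by exists (- c^-1 *: (x - c *: v)).
  rewrite scaleNr opprK scalerBr scalerA mulVf // scale1r addrC subrK => h.
  have -> : nrm y = nrm c * nrm (c^-1 *: y).
    by rewrite nrmZ mulrA -nrmM divff // nrm_real ?normr1 ?mul1r.
  by rewrite ler_wpM2l ?nrm_ge0.
have h1 := hC _ _ T1.1 T1.2.
have h2 : nrm x <= nrm (x - c *: v) + nrm c * nrm v.
  by rewrite -nrmZ -{1}(subrK (c *: v) x) nrmD.
have h3 : nrm (y - c *: w) <= nrm y + nrm c * nrm w by rewrite -nrmZ nrmB.
have h4 : nrm c <= nrm y / d by rewrite ler_pdivlMr.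
have h5 : C * nrm (y - c *: w) <= C * (nrm y + nrm c * nrm w) by rewrite ler_wpM2l.
have h6 : nrm c * (C * nrm w + nrm v) <= nrm y / d * (C * nrm w + nrm v).
  by rewrite ler_wpM2r // addr_ge0 ?mulr_ge0 ?nrm_ge0.
have -> : (C + (C * nrm w + nrm v) / d) * nrm y = C * nrm y + nrm y / d * (C * nrm w + nrm v).
  by field; rewrite lt0r_neq0.
move: h1 h2 h5 h6; rewrite !mulrDr; lra.
Qed.

(** Injectivity of a closed relation improves to a lower bound as soon as there
    is one on a subspace of finite codimension.  In a Pontryagin space such a
    subspace is available on which the form is positive.  This replaces compactness
    of the unit ball of the negative subspace: it yields the regularity of nonreal
    points ([regular_bound]) and the continuity of isometric relations
    ([total_isometry_bounded]). *)
Lemma bounded_below_codim (s : seq V) T : linear_subspace (T : set (V * W)%type) ->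
  closed (T : set (V * W)%type) -> (forall x, T (x, 0) -> x = 0) ->
  (exists2 C : R, 0 <= C &
     forall x y, T (x, y) -> (forall e, e \in s -> f x e = 0) -> nrm x <= C * nrm y) ->
  exists2 C : R, 0 <= C & forall x y, T (x, y) -> nrm x <= C * nrm y.
Proof.
elim: s T => [|e s IH] T linT cT injT [C C0 hC].
  by exists C => // x y Txy; apply: hC.
apply: (bounded_below_codim1 (e := e)) => //.
have [linT' cT'] := restrict_kernel e linT cT.
have [||D D0 hD] := IH _ linT' cT'.
- by move=> x [/injT].
- exists C => // x y [Txy fx] h; apply: hC => // u.
  by rewrite inE => /orP[/eqP ->|/h].
by exists D => // x y Txy fx; apply: hD.
Qed.
End ClosedRelations.

(** * Symmetric operators and their defect spaces *)

(** The operators to which the argument applies: closed, symmetric, without nonreal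
    eigenvalues, and with defect spaces that are total when all nonreal points
    are taken together. *)
Record simple_symmetric {R : realType} {V : completeNormedModType R[i]}
    (f : {hermitian V for false & Num.conj}) (A : set (V * V)) : Prop := {
  ss_pontryagin : pontryagin_form f;
  ss_linear : linear_subspace (A : set (V * V)%type);
  ss_closed : closed (A : set (V * V)%type);
  ss_symmetric : A `<=` rel_adj f A;
  ss_no_eigenvalue : forall (l : R[i]) x, Im l != 0 -> A (x, l *: x) -> x = 0;
  ss_simple : forall z, (forall (l : R[i]) x, Im l != 0 ->
    rel_adj f A (x, l *: x) -> f z x = 0) -> z = 0
}.

Lemma sym_diag_real {R : realType} {V : completeNormedModType R[i]}
    (f : {hermitian V for false & Num.conj}) (A : set (V * V)) x y :
  A `<=` rel_adj f A -> A (x, y) -> Im (f y x) = 0.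
Proof.
move=> symA Axy; have /= h := symA _ Axy _ _ Axy.
have := formC (hermitian_formP f) x y; rewrite h; case: (f y x) => a b [] hh.
by apply/eqP; rewrite -eqNr -hh.
Qed.

Section SymmetricOperator.
Context {R : realType} {V : completeNormedModType R[i]}.
Variables (f : {hermitian V for false & Num.conj}) (A : set (V * V)).
Hypothesis hA : simple_symmetric f A.

Let hf := ss_pontryagin hA.
Let linA := ss_linear hA.
Let clA := ss_closed hA.
Let symA := ss_symmetric hA.
Let no_eigenvalue := ss_no_eigenvalue hA.
Let hb : bounded_form f := pontryagin_bounded hf.

Definition ran_shift l : set V := [set z | exists x, A (x, z + l *: x)].

Definition bound_at l C := forall x y, A (x, y) -> nrm x <= C * nrm (y - l *: x).

Lemma A_comb a x y x' y' : A (x, y) -> A (x', y') -> A (a *: x + x', a *: y + y').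
Proof. exact: (linA.2 a (x, y) (x', y')). Qed.

Lemma A_sub x y x' y' : A (x, y) -> A (x', y') -> A (x - x', y - y').
Proof. exact: (@subspaceB _ _ _ linA (x, y) (x', y')). Qed.

Lemma A_scale a x y : A (x, y) -> A (a *: x, a *: y).
Proof. exact: (@subspaceZ _ _ _ linA a (x, y)). Qed.

Definition shift_rel l : set (V * V) := [set q | A (q.1, q.2 + l *: q.1)].

Lemma shift_rel_linear l : linear_subspace (shift_rel l : set (V * V)%type).
Proof.
split=> [|a x y Ax Ay]; rewrite /shift_rel /=.
  by rewrite scaler0 addr0; exact: (subspace0 linA).
have -> : a *: x.2 + y.2 + l *: (a *: x.1 + y.1) =
          a *: (x.2 + l *: x.1) + (y.2 + l *: y.1).
  by rewrite !scalerDr !scalerA [l * a]mulrC addrACA.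
exact: A_comb.
Qed.

Lemma shift_rel_closed l : closed (shift_rel l : set (V * V)%type).
Proof.
apply/closed_approx2 => p h; move/closed_approx2: clA; apply => e e0.
have n0 : 0 < nrm l + 1 by rewrite ltr_wpDl // nrm_ge0.
have [|q Aq [q1 q2]] := h (e / (2 * (nrm l + 1))).
  by rewrite divr_gt0 // mulr_gt0.
exists (q.1, q.2 + l *: q.1) => //=.
have e1 : e / (2 * (nrm l + 1)) <= e / 2.
  by rewrite ler_pM2l // lef_pV2 ?posrE ?mulr_gt0 // ler_peMr // lerDr nrm_ge0.
have e2 : nrm l * (e / (2 * (nrm l + 1))) <= e / 2.
  have -> : e / 2 = (nrm l + 1) * (e / (2 * (nrm l + 1))) by field; rewrite lt0r_neq0.
  by rewrite ler_wpM2r ?lerDl // divr_ge0 ?mulr_ge0 // ltW.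
split; first by apply: lt_le_trans q1 _; lra.
have -> : p.2 + l *: p.1 - (q.2 + l *: q.1) = (p.2 - q.2) + l *: (p.1 - q.1).
  by rewrite scalerBr opprD addrACA.
apply: le_lt_trans (nrmD _ _) _; rewrite nrmZ.
have : nrm l * nrm (p.1 - q.1) <= nrm l * (e / (2 * (nrm l + 1))).
  by rewrite ler_wpM2l ?nrm_ge0 // ltW.
move: q2 e1 e2; lra.
Qed.

(** On vectors where the form is positive, the imaginary part of
    [f (y - l x) x] is [- Im l * f x x], which bounds [x] by [y - l x].  The other
    vectors cost finitely many dimensions, and injectivity takes care of them. *)
Lemma regular_bound l : Im l != 0 -> exists2 C : R, 0 <= C & bound_at l C.
Proof.
move=> l0; have [k [e [c c0 hc]]] := pontryagin_index hf.
have [K K0 hK] := form_bounded hb.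
have [||||C C0 hC] := @bounded_below_codim _ _ _ _ hb [seq e i | i <- enum 'I_k] (shift_rel l).
- exact: shift_rel_linear.
- exact: shift_rel_closed.
- by move=> x; rewrite /shift_rel /= add0r; apply: no_eigenvalue.
- have il : 0 < `|Im l| * c by rewrite mulr_gt0 // normr_gt0.
  exists (K / (`|Im l| * c)); first by rewrite divr_ge0 // ltW.
  move=> x y Axy ex; have {}hc : c * nrm x ^+ 2 <= Re (f x x).
    by apply: hc => i; apply: ex; apply: map_f; rewrite mem_enum.
  have im : Im (f y x) = - (Im l * Re (f x x)).
    have := sym_diag_real symA Axy; rewrite (formDl hb) (formZl hb) ImD ImM.
    rewrite (form_diag_real hb) mulr0 add0r => /eqP; rewrite addr_eq0 => /eqP ->.
    by [].
  have h1 : `|Im l| * c * nrm x ^+ 2 <= K * nrm y * nrm x.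
    apply: le_trans (hK y x); apply: le_trans (absIm_le _); rewrite im normrN normrM.
    rewrite -mulrA ler_wpM2l //; apply: le_trans hc _; exact: ler_norm.
  have [->|x0] := eqVneq x 0.
    by rewrite nrm0 mulr_ge0 ?nrm_ge0 // divr_ge0 // ltW.
  have nx : 0 < nrm x by apply: nrm_gt0; apply/eqP.
  rewrite mulrAC ler_pdivlMr // -(ler_pM2r nx); apply: le_trans h1.
  by rewrite le_eqVlt; apply/orP; left; apply/eqP; ring.
exists C => // x y Axy; apply: hC; rewrite /shift_rel /=.
by rewrite subrK.
Qed.

Lemma ran_shift_linear l : linear_subspace (ran_shift l).
Proof.
split=> [|a x y [x' Ax] [y' Ay]].
  by exists 0; rewrite scaler0 addr0; exact: (subspace0 linA).
exists (a *: x' + y').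
exact: ((shift_rel_linear l).2 a (x', x) (y', y) Ax Ay).
Qed.

Lemma ran_shift_closed l : Im l != 0 -> closed (ran_shift l).
Proof.
move=> /regular_bound[C C0 hC].
rewrite -[ran_shift l]/([set y | exists x, shift_rel l (x, y)]).
apply: (@closed_range _ V V (shift_rel l) C) => //.
- exact: shift_rel_linear.
- exact: shift_rel_closed.
move=> x y h; by apply: le_trans (hC _ _ h) _; rewrite addrK.
Qed.

(** The closed range of [A - l] is the orthogonal companion of the defect space
    at the conjugate point. *)
Lemma ran_shiftP l z : Im l != 0 ->
  ran_shift l z <-> forall x, rel_adj f A (x, (l^*)%C *: x) -> f z x = 0.
Proof.
move=> l0; split=> [[x' Ax'] x Kx|h].
  have := Kx _ _ Ax'; rewrite /= (formDl hb) (formZl hb) (formZr hb) conjcK.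
  by move/eqP; rewrite -subr_eq0 opprD addrCA subrr addr0 oppr_eq0 => /eqP.
apply: contrapT => nz.
have [y y1 y2] := separation hf (ran_shift_linear l) (ran_shift_closed l0) nz.
apply: y2; apply: h => u v Auv /=.
rewrite (formZr hb) conjcK; have /y1 : ran_shift l (v - l *: u).
  by exists u; rewrite subrK.
by rewrite (formBl hb) (formZl hb) => /eqP; rewrite subr_eq0 => /eqP ->.
Qed.

(** The first resolvent identity, for a symmetric operator whose resolvents are
    defined only at suitable vectors. *)
Lemma resolvent_identity l m x x' z : l != m ->
  A (x, z + l *: x) -> A (x', z + m *: x') -> ran_shift m x.
Proof.
move=> lm Ax Ax'; exists ((l - m)^-1 *: (x - x')).
have lm0 : l - m != 0 by rewrite subr_eq0.
have -> : x + m *: ((l - m)^-1 *: (x - x')) =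
          (l - m)^-1 *: (z + l *: x - (z + m *: x')).
  have -> : z + l *: x - (z + m *: x') = (l - m) *: x + m *: (x - x').
    rewrite opprD addrACA subrr add0r scalerBl scalerBr addrA subrK //.
  by rewrite [RHS]scalerDr !scalerA mulVf // scale1r [_ * m]mulrC.
by apply: A_scale; apply: A_sub.
Qed.

Section Continuation.
Variable Om : set R[i].
Hypothesis nonreal_Om : forall l, Om l -> Im l != 0.

Let N : set V := [set z | forall l, Om l -> ran_shift l z].

Let linN : linear_subspace N.
Proof.
split=> [l _|a x y Nx Ny l Ol]; first exact: (subspace0 (ran_shift_linear l)).
by apply: (ran_shift_linear l).2; [exact: Nx|exact: Ny].
Qed.

Let clN : closed N.
Proof.
apply/closed_approx => x h l Ol; have := ran_shift_closed (nonreal_Om Ol).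
move/closed_approx; apply => e e0; have [y Ny xy] := h e e0.
by exists y => //; apply: Ny.
Qed.

(** [N] is the set of vectors orthogonal to the defect spaces at the conjugates of
    [Om]; the property says that the part of [A] in [N], minus [l], is onto [N]. *)
Definition onto_at l := forall z, N z -> exists2 x, N x & A (x, z + l *: x).

(** [N] is invariant under the resolvent at [l1]: by the resolvent identity
    [x = (A - l1)^-1 z] is in the range of [A - l] for [l] other than [l1], while for
    [l1] itself one approximates [x] by [(A - l)^-1 z]. *)
Lemma onto_at_accumulation l1 : Om l1 ->
  (forall d : R, 0 < d -> exists2 l, Om l & l != l1 /\ nrm (l - l1) < d) ->
  onto_at l1.
Proof.
move=> O1 acc z Nz; have [x Ax] := Nz _ O1; exists x => // l Ol.
have [->|ll1] := eqVneq l l1; last first.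
  by have [x' Ax'] := Nz _ Ol; apply: resolvent_identity Ax Ax'; rewrite eq_sym.
have [C C0 hC] := regular_bound (nonreal_Om O1).
have := ran_shift_closed (nonreal_Om O1); move/closed_approx; apply => e e0.
pose d := Num.min (2 * C + 1)^-1 (e / (2 * C * nrm x + 1)).
have p1 : 0 < 2 * C + 1 by rewrite ltr_wpDl // mulr_ge0.
have p2 : 0 < 2 * C * nrm x + 1 by rewrite ltr_wpDl // !mulr_ge0 // nrm_ge0.
have [|l' Ol' [nl' dl']] := acc d.
  by rewrite lt_min invr_gt0 p1 divr_gt0.
have [x' Ax'] := Nz _ Ol'; exists x'; first exact: resolvent_identity Ax' Ax.
have := hC _ _ (A_sub Ax Ax').
have -> : z + l1 *: x - (z + l' *: x') - l1 *: (x - x') = (l1 - l') *: x'.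
  rewrite opprD addrACA subrr add0r scalerBr opprB [LHS]addrC subrKA.
  by rewrite scalerBl.
rewrite nrmZ [nrm (l1 - l')]nrmBC => h; move: dl'; rewrite lt_min => /andP[d1 d2].
rewrite -[X in _ < X]mul1r ltr_pdivlMr // in d1.
rewrite ltr_pdivlMr // in d2.
have h' : nrm x' <= nrm x + nrm (x' - x) by exact: nrm_le_sub.
move: d1 d2 h h' (nrm_ge0 (l' - l1)) (nrm_ge0 x) (nrm_ge0 x') (nrm_ge0 (x' - x)).
rewrite [nrm (x - x')]nrmBC.
move: (nrm (l' - l1)) (nrm x) (nrm x') (nrm (x' - x)) => a p q r.
move=> d1 d2 h h' a0 p0 q0 r0; clear -C0 d1 d2 h h' a0 p0 q0 r0.
have k1 : C * (a * q) <= C * (a * (p + r)) by rewrite !ler_wpM2l.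
have k2 : (2 * (C * a)) * r <= 1 * r.
  by apply: ler_wpM2r => //; nra.
by nra.
Qed.

(** The range of the part of [A - m] in [N] is closed.  If [w] in [N] is [g]-orthogonal
    to it, then, with [x = (A - l)^-1 w], it is orthogonal to
    [(A - m) x = w + (l - m) x], a small perturbation of [w]; hence [w = 0]. *)
Lemma onto_at_step : exists2 k : R, 0 < k & forall (l m : R[i]) (C : R), Im m != 0 ->
  0 <= C -> bound_at l C -> nrm (m - l) * C < k -> onto_at l -> onto_at m.
Proof.
have [g [J [hg [c c0 hc] _]]] := pontryagin_gram hf.
have [K K0 hK] := form_bounded hg.
have K1 : 0 < K + 1 by rewrite ltr_wpDl.
exists (c / (K + 1)); first by rewrite divr_gt0.
move=> l m C m0 C0 hC small onto z Nz.
pose T := [set q : V * V | shift_rel m q /\ N q.1 /\ N q.2].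
have linT : linear_subspace (T : set (V * V)%type).
  split=> [|a x y [Tx [Nx Nx']] [Ty [Ny Ny']]].
    by split; [exact: (subspace0 (shift_rel_linear m))|split; exact: (subspace0 linN)].
  by split; [exact: (shift_rel_linear m).2|split; exact: linN.2].
have clT : closed (T : set (V * V)%type).
  apply/closed_approx2 => p h; split; last split.
  - move: (@shift_rel_closed m) => /closed_approx2; apply => d d0.
    by have [q [Tq _] ?] := h d d0; exists q.
  - move: clN => /closed_approx; apply => d d0.
    by have [q [_ [Nq _]] [? _]] := h d d0; exists q.1.
  - move: clN => /closed_approx; apply => d d0.
    by have [q [_ [_ Nq]] [_ ?]] := h d d0; exists q.2.
have [D D0 hD] := regular_bound m0.
pose M := [set y | exists x, T (x, y)].
have clM : closed M.
  apply: (@closed_range _ V V T D) => // x y [h _].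
  by apply: le_trans (hD _ _ h) _; rewrite addrK.
have linM : linear_subspace M.
  split=> [|a x y [x' hx] [y' hy]]; first by exists 0; exact: (subspace0 linT).
  by exists (a *: x' + y'); exact: (linT.2 a (x', x) (y', y)).
have [u Mu wM] := projection_exists hg (ex_intro2 _ _ c c0 hc) z linM clM.
have Nu : N u by case: Mu => x [_ []].
set w := z - u in wM.
have Nw : N w by exact: (subspaceB linN).
have [x Nx Ax] := onto _ Nw.
have Mx : M (w + (l - m) *: x).
  exists x; split; first by rewrite /shift_rel /= -addrA -scalerDl subrK.
  by split=> //; apply: (subspaceD linN) => //; apply: (subspaceZ linN).
have nx : nrm x <= C * nrm w by apply: le_trans (hC _ _ Ax) _; rewrite addrK.
have w0 : w = 0.
  have := wM _ Mx; rewrite (formDr hg) (formZr hg) => /eqP.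
  rewrite addr_eq0 => /eqP gw; have := hc w; rewrite gw => h1.
  have h2 : c * nrm w ^+ 2 <= nrm (m - l) * (K * nrm w * nrm x).
    apply: le_trans h1 (le_trans (Re_le _) _).
    by rewrite nrmN nrmM nrmJ nrmBC ler_wpM2l ?nrm_ge0.
  have h3 : nrm (m - l) * (K * nrm w * nrm x) <= nrm (m - l) * C * K * nrm w ^+ 2.
    have -> : nrm (m - l) * C * K * nrm w ^+ 2 = nrm (m - l) * (K * nrm w * (C * nrm w)) by ring.
    by rewrite ler_wpM2l ?nrm_ge0 // ler_wpM2l // mulr_ge0 ?nrm_ge0.
  have h4 : nrm (m - l) * C * K <= c * (K / (K + 1)).
    by rewrite mulrCA mulrC ler_wpM2l // ltW.
  have h5 : K / (K + 1) < 1 by rewrite ltr_pdivrMr // mul1r ltrDl.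
  have [//|wn] := eqVneq w 0.
  have nw : 0 < nrm w ^+ 2 by rewrite exprn_gt0 // nrm_gt0 //; apply/eqP.
  have := le_trans h2 h3; rewrite ler_pM2r // => h6.
  by have := le_lt_trans (le_trans h6 h4) (_ : _ < c * 1);
     rewrite ltr_pM2l // h5 mulr1 ltxx => /(_ isT).
have zu : z = u by apply/eqP; rewrite -subr_eq0; apply/eqP.
by rewrite zu; case: Mu => y [h [Ny _]]; exists y.
Qed.

(** The lower bound for [A - l] survives, up to a factor 2, for all nearby points,
    so the step can be taken in both directions. *)
Lemma onto_at_local l : Im l != 0 -> exists2 d : R, 0 < d &
  forall m : R[i], Im m != 0 -> nrm (m - l) < d -> onto_at l <-> onto_at m.
Proof.
move=> l0; have [C C0 hC] := regular_bound l0.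
have [k k0 step] := onto_at_step.
have C1 : 0 < 2 * C + 1 by rewrite ltr_wpDl // mulr_ge0.
have C2 : 0 < (2 * C + 1)^-1 by rewrite invr_gt0.
exists (Num.min k 1 / (2 * C + 1)).
  by rewrite divr_gt0 // lt_min k0 ltr01.
move=> m m0; rewrite ltr_pdivlMr // lt_min => /andP[d1 d2].
have n0 : 0 <= nrm (m - l) := nrm_ge0 _.
have nC : 0 <= nrm (m - l) * C by rewrite mulr_ge0.
split.
  by apply: (step l m C) => //; apply: le_lt_trans d1; nra.
apply: (step m l (2 * C)) => //; first by rewrite mulr_ge0.
  move=> x y Axy; have h1 := hC _ _ Axy.
  have : nrm (y - l *: x) <= nrm (y - m *: x) + nrm (m - l) * nrm x.
    have -> : y - l *: x = (y - m *: x) + (m - l) *: x.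
      by rewrite scalerBl addrA subrK.
    by rewrite -nrmZ nrmD.
  move: h1 d2 C0 n0 (nrm_ge0 x) (nrm_ge0 (y - m *: x)).
  move: (nrm x) (nrm (y - l *: x)) (nrm (y - m *: x)) (nrm (m - l)) => a b d e.
  move=> h1 d2 C0 e0 a0 b0 h2.
  have h3 : C * b <= C * (d + e * a) by rewrite ler_wpM2l.
  have h4 : (2 * (e * C)) * a <= 1 * a by apply: ler_wpM2r => //; nra.
  by nra.
by rewrite nrmBC; apply: le_lt_trans d1; nra.
Qed.

(** A locally constant property is constant along the segment from [l] to [m]; the
    supremum of the parameters where it holds cannot be less than 1. *)
Lemma onto_at_half_plane l m : 0 < Im l * Im m -> onto_at l -> onto_at m.
Proof.
move=> lm.
pose p (t : R) := l + t%:C%C * (m - l).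
have p0 : p 0 = l by rewrite /p rmorph0 mul0r addr0.
have p1 : p 1 = m by rewrite /p rmorph1 mul1r addrC subrK.
have Ip t : 0 <= t -> t <= 1 -> Im (p t) != 0.
  move=> t0 t1; rewrite /p !ReImE /= mul0r addr0.
  have -> : Im l + t * (Im m - Im l) = (1 - t) * Im l + t * Im m by ring.
  exact: segment_avoids0.
have pd s t : nrm (p s - p t) = `|s - t| * nrm (m - l).
  by rewrite /p opprD addrACA subrr add0r -mulrBl -rmorphB nrmM nrm_real.
have loc t : 0 <= t -> t <= 1 -> exists2 e : R, 0 < e &
    forall s, 0 <= s -> s <= 1 -> `|s - t| < e -> onto_at (p t) <-> onto_at (p s).
  move=> t0 t1; have [d d0 hd] := onto_at_local (Ip t t0 t1).
  have n1 : 0 < nrm (m - l) + 1 by rewrite ltr_wpDl // nrm_ge0.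
  exists (d / (nrm (m - l) + 1)); first by rewrite divr_gt0.
  move=> s s0 s1 st; apply: hd; first exact: Ip.
  rewrite pd; rewrite ltr_pdivlMr // in st; apply: le_lt_trans st.
  by rewrite ler_wpM2l // lerDl.
move=> ol; rewrite -p1.
(* the supremum [c] of [E] is in [E], and could be exceeded if it were less than 1 *)
pose E := [set t : R | [/\ 0 <= t, t <= 1 & onto_at (p t)]].
have E0 : E 0 by split=> //; rewrite p0.
have hE : has_sup E.
  by split; [exists 0|exists 1 => t []].
pose c := sup E.
have c0 : 0 <= c by apply: sup_upper_bound.
have c1 : c <= 1 by apply: ge_sup; [exists 0|move=> t []].
have [e e0 he] := loc c c0 c1.
have oc : onto_at (p c).
  have [t [t0 t1 ot] ct] := sup_adherent e0 hE.
  apply/(he t) => //; rewrite -/c in ct.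
  have tc : t <= c by apply: sup_upper_bound.
  rewrite distrC ger0_norm ?subr_ge0 //; lra.
have [->|cn] := eqVneq 1 c; first exact: oc.
have c1' : c < 1 by rewrite lt_neqAle eq_sym cn.
pose s := Num.min 1 (c + e / 2).
have s1 : s <= 1 by rewrite ge_min lexx.
have cs : c < s by rewrite lt_min c1' ltrDl divr_gt0.
have sc : s <= c + e / 2 by rewrite ge_min lexx orbT.
have Es : E s.
  have s0 : 0 <= s by apply: le_trans c0 (ltW cs).
  split=> //; apply/(he s) => //.
  rewrite ger0_norm ?subr_ge0 ?(ltW cs) //.
  have : e / 2 < e by rewrite ltr_pdivrMr // ltr_pMr // ltr1n.
  lra.
have : s <= c by apply: sup_upper_bound.
by rewrite leNgt cs.
Qed.

End Continuation.

(** Sets of points whose defect spaces determine the operator: they meet both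
    half-planes and have no isolated points. *)
Record ample (L : set R[i]) : Prop := {
  ample_nonreal : forall l, L l -> Im l != 0;
  ample_perfect : forall l, L l -> forall d : R, 0 < d ->
    exists2 m, L m & m != l /\ nrm (m - l) < d;
  ample_both : forall m : R[i], Im m != 0 -> exists2 l, L l & 0 < Im l * Im m
}.

Lemma ample_remove L m : ample L -> ample [set l | L l /\ l != m].
Proof.
case=> nr perf both; split=> [l [/nr]//|l [Ll lm] d d0|n n0].
  have lm0 : 0 < nrm (l - m) by apply: nrm_gt0; apply/eqP; rewrite subr_eq0.
  have [|q Lq [ql]] := perf _ Ll (Num.min d (nrm (l - m))).
    by rewrite lt_min d0.
  rewrite lt_min => /andP[q1 q2]; exists q; split=> //.
  by apply: contraTneq q2 => ->; rewrite nrmBC ltxx.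
have [l Ll ln] := both _ n0.
have [lm|lm] := eqVneq l m; last by exists l.
have l0 : 0 < `|Im l| by rewrite normr_gt0; apply: nr.
have [q Lq [ql qd]] := perf _ Ll _ l0; exists q; first by split=> //; rewrite -lm.
have : `|Im q - Im l| < `|Im l|.
  by apply: le_lt_trans qd; rewrite -ImN -ImD; apply: absIm_le.
exact: same_sign_near ln.
Qed.

(** A vector orthogonal to the defect spaces over an ample set lies in the ranges
    of [A - l] for [l] in the conjugate set.  By continuation in each half-plane it
    lies in the range at every nonreal point, so it is orthogonal to all defect
    spaces. *)
Lemma defect_total L z : ample L ->
  (forall l x, L l -> rel_adj f A (x, l *: x) -> f z x = 0) -> z = 0.
Proof.
move=> [nr perf both] h; apply: (ss_simple hA) => l x l0 Kx.
pose Om := [set l | L (l^*)%C].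
have nrO m : Om m -> Im m != 0 by move=> /nr; rewrite ImJ oppr_eq0.
have Nz m : Om m -> ran_shift m z.
  by move=> Om_m; apply/ran_shiftP; [exact: nrO|move=> y; apply: h].
have [l1 L1 l1l] := both l l0.
have o1 : onto_at Om (l1^*)%C.
  apply: onto_at_accumulation => //; first by rewrite /Om /= conjcK.
  move=> d d0; have [m Lm [ml md]] := perf _ L1 _ d0.
  exists (m^*)%C; first by rewrite /Om /= conjcK.
  by rewrite (inj_eq (can_inj (@conjcK R))) -rmorphB nrmJ.
have /(_ z Nz)[y _ Ay] : onto_at Om (l^*)%C.
  by apply: onto_at_half_plane o1; rewrite // !ImJ mulrNN.
have : ran_shift (l^*)%C z by exists y.
by move/ran_shiftP; rewrite ImJ oppr_eq0 conjcK; apply.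
Qed.

(** The pairs [(x, l x)] with [x] in a defect space over an ample set have [A] as
    their orthogonal companion.  If [(y, y')] is orthogonal to them and
    [m] is conjugate to a point of the set, then [y' - m y = (A - m) a] for some [a],
    and [a - y] is orthogonal to the defect spaces at all other points, whence
    [a = y]. *)
Lemma defect_orthogonal L y y' : ample L ->
  (forall l x, L l -> rel_adj f A (x, l *: x) -> f x y' = l * f x y) -> A (y, y').
Proof.
move=> aL h; have i1 : Im ('i%C : R[i]) != 0 by rewrite /= oner_eq0.
have [l Ll _] := ample_both aL i1.
have l0 : Im (l^*)%C != 0 by rewrite ImJ oppr_eq0; apply: (ample_nonreal aL).
have [a Aa] : ran_shift (l^*)%C (y' - (l^*)%C *: y).
  apply/ran_shiftP => // x; rewrite conjcK => Kx; apply: (form_eq0_sym hb).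
  by rewrite (formBr hb) (formZr hb) conjcK (h l) ?subrr.
have /eqP : a - y = 0.
  apply: (defect_total (ample_remove l aL)) => m x [Lm ml] Kx.
  have e1 : f a (m *: x) = f (y' - (l^*)%C *: y + (l^*)%C *: a) x := Kx _ _ Aa.
  have e2 : f y' x = (m^*)%C * f y x.
    by rewrite (formC hb x y') (h m) // rmorphM /= -(formC hb).
  have : ((m^*)%C - (l^*)%C) * f (a - y) x = 0.
    move: e1; rewrite (formZr hb) (formDl hb) !(formBl hb) !(formZl hb) e2 => e1.
    by rewrite mulrBl mulrBr e1; ring.
  move/eqP; rewrite mulf_eq0 subr_eq0 (inj_eq (can_inj (@conjcK R))) (negPf ml) /=.
  by move/eqP.
rewrite subr_eq0 => /eqP ay; move: Aa; rewrite ay subrK //.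
Qed.
End SymmetricOperator.

(** * Weak limits in Hilbert spaces *)

Section Limits.
Context {R : realType}.

Lemma limit_unique (W : normedZmodType R[i]) (u : nat -> W) x y :
  limit_of u x -> limit_of u y -> x = y.
Proof.
move=> ux uy; apply/eqP; rewrite -subr_eq0; apply/eqP.
apply: (@small_eq0 _ _ _ 2) => e e0.
have [N1 h1] := ux e e0; have [N2 h2] := uy e e0.
have {}h1 := h1 (maxn N1 N2) (leq_maxl _ _).
have {}h2 := h2 (maxn N1 N2) (leq_maxr _ _).
apply: le_trans (nrm_tri (u (maxn N1 N2)) _ _) _.
by rewrite nrmBC; move: h1 h2; lra.
Qed.

Lemma limitD (W : normedZmodType R[i]) (u v : nat -> W) x y :
  limit_of u x -> limit_of v y -> limit_of (fun n => u n + v n) (x + y).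
Proof.
move=> ux vy e e0; have e2 : 0 < e / 2 by rewrite divr_gt0.
have [N1 h1] := ux _ e2; have [N2 h2] := vy _ e2.
exists (maxn N1 N2) => n; rewrite geq_max => /andP[/h1 {}h1 /h2 {}h2].
rewrite opprD addrACA; apply: le_lt_trans (nrmD _ _) _.
by move: h1 h2; lra.
Qed.

Lemma limitM (u : nat -> R[i]) (a x : R[i]) :
  limit_of u x -> limit_of (fun n => a * u n) (a * x).
Proof.
move=> ux e e0; have a1 : 0 < nrm a + 1 by rewrite ltr_wpDl // nrm_ge0.
have [|N h] := ux (e / (nrm a + 1)); first by rewrite divr_gt0.
exists N => n /h; rewrite -mulrBr nrmM ltr_pdivlMr // mulrC => /(le_lt_trans _); apply.
by rewrite ler_wpM2r ?nrm_ge0 // lerDl.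
Qed.

Lemma limit_cst (W : normedZmodType R[i]) (x : W) : limit_of (fun=> x) x.
Proof. by move=> e e0; exists 0%N => n _; rewrite subrr nrm0. Qed.

Lemma limit_form (V : normedModType R[i]) (g : V -> V -> R[i]) (u : nat -> V) x y :
  bounded_form g -> limit_of u x -> limit_of (fun n => g y (u n)) (g y x).
Proof.
move=> hg ux e e0; have [K K0 hK] := form_bounded hg.
have k1 : 0 < K * nrm y + 1 by rewrite ltr_wpDl // mulr_ge0 // nrm_ge0.
have [|N h] := ux (e / (K * nrm y + 1)); first by rewrite divr_gt0.
exists N => n /h; rewrite -(formBr hg) ltr_pdivlMr // mulrC => /(le_lt_trans _); apply.
by apply: le_trans (hK _ _) _; rewrite ler_wpM2r ?nrm_ge0 // lerDl.
Qed.
End Limits.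

Section HilbertSpace.
Context {R : realType} {G : completeNormedModType R[i]}.
Variable ip : {dot G for Num.conj}.
Hypothesis hip : hilbert_ip ip.

Lemma ip_nrm x : Re (ip x x) = nrm x ^+ 2.
Proof. by rewrite -hip normE -rmorphXn. Qed.

Lemma ip_hermitian : hermitian_form ip. Proof. exact: hermitian_formP. Qed.

Lemma ip_cauchy_schwarz x y : nrm (ip x y) <= nrm x * nrm y.
Proof.
rewrite -ler_sqr ?nnegrE ?mulr_ge0 ?nrm_ge0 // exprMn -!ip_nrm.
apply: (form_cauchy_schwarz ip_hermitian) => z; rewrite ip_nrm; exact: sqr_ge0.
Qed.

Lemma ip_bounded : bounded_form ip.
Proof.
split; first exact: ip_hermitian.
by exists 1 => // x y; rewrite mul1r; exact: ip_cauchy_schwarz.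
Qed.

Lemma ip_coercive : coercive ip.
Proof. by exists 1 => // x; rewrite mul1r ip_nrm. Qed.

Let hb := ip_bounded.

(** Of the two points [x + y] and [x - y], with [y] the multiple of [h] of norm [d],
    one has this property, since the values there differ by [2 * ip y h]. *)
Lemma large_nearby_value x h (d : R) : 0 <= d -> exists2 x', nrm (x' - x) <= d &
  d * nrm h <= nrm (ip x' h).
Proof.
move=> d0; have [->|h0] := eqVneq h 0.
  exists x; first by rewrite subrr nrm0.
  by rewrite nrm0 mulr0 nrm_ge0.
have nh : 0 < nrm h by apply: nrm_gt0; apply/eqP.
pose y := (d / nrm h)%:C%C *: h.
have ny : nrm y = d.
  by rewrite nrmZ nrm_real ger0_norm ?divr_ge0 ?nrm_ge0 // divfK // gt_eqF.
have iy : nrm (ip y h) = d * nrm h.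
  rewrite (formZl hb) nrmM nrm_real ger0_norm ?divr_ge0 ?nrm_ge0 //.
  have -> : ip h h = (nrm h ^+ 2)%:C%C by rewrite -hip normE -rmorphXn.
  by rewrite nrm_real ger0_norm ?sqr_ge0 //; field; rewrite gt_eqF.
have [hp|hm] := leP (d * nrm h) (nrm (ip (x + y) h)).
  by exists (x + y) => //; rewrite addrC addKr ny.
exists (x - y); first by rewrite addrC addKr nrmN ny.
have : nrm (ip (x + y) h - ip (x - y) h) = 2 * (d * nrm h).
  rewrite (formDl hb) (formBl hb).
  have -> : ip x h + ip y h - (ip x h - ip y h) = 2%:R * ip y h by ring.
  by rewrite nrmM iy -(rmorph_nat (real_complex R)) nrm_real ger0_norm.
have := nrmB (ip (x + y) h) (ip (x - y) h).
by move: hm; lra.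
Qed.

Lemma third_small (n : nat) : (3^-1 : R) ^+ n <= n.+1%:R^-1.
Proof.
suff : n.+1%:R * (3^-1 : R) ^+ n <= 1.
  by rewrite -ler_pdivlMl ?ltr0n // mulr1.
elim: n => [|n IH]; first by rewrite expr0 mulr1.
apply: le_trans IH; rewrite exprS mulrA ler_wpM2r ?exprn_ge0 ?invr_ge0 //.
by rewrite ler_pdivrMr // -natrM ler_nat mulSn -addn2 addnC leq_add // leq_pmulr.
Qed.

(** Gliding hump: if the [h n] were unbounded, one could choose [u j.+1] within
    [3^-j] of [u j] so that its product with a very large [h (nn j)] is large; the
    total length of the later steps is only half of [3^-j], so the limit of [u]
    inherits these large values. *)
Lemma uniform_boundedness (h : nat -> G) :
  (forall x, exists M N, forall n, (N <= n)%N -> nrm (ip x (h n)) <= M) ->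
  exists M N, forall n, (N <= n)%N -> nrm (h n) <= M.
Proof.
move=> pb; apply: contrapT => unb.
have big (M : R) N : exists n, (N <= n)%N /\ M < nrm (h n).
  apply: contrapT => no; apply: unb; exists M, N => n Nn.
  by rewrite leNgt; apply/negP => Mn; apply: no; exists n.
pose r : R := 3^-1; have r0 : 0 < r by rewrite invr_gt0.
have rn j : 0 < r ^+ j by rewrite exprn_gt0.
pose nn j := projT1 (cid (big (2 * j%:R / r ^+ j) j)).
have nnj j : (j <= nn j)%N by have [] := projT2 (cid (big (2 * j%:R / r ^+ j) j)).
have nnb j : 2 * j%:R / r ^+ j < nrm (h (nn j)).
  by have [] := projT2 (cid (big (2 * j%:R / r ^+ j) j)).
have st j x := cid2 (large_nearby_value x (h (nn j)) (ltW (rn j))).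
pose u n := iteri n (fun j x => sval (st j x)) 0.
have u1 j : nrm (u j.+1 - u j) <= r ^+ j.
  by rewrite /u /=; exact: (s2valP (st j _)).
have u2 j : r ^+ j * nrm (h (nn j)) <= nrm (ip (u j.+1) (h (nn j))).
  by rewrite /u /=; exact: (s2valP' (st j _)).
have tail m k : nrm (u (m + k)%N - u m) <= (3 / 2) * r ^+ m - (3 / 2) * r ^+ (m + k).
  elim: k => [|k IH]; first by rewrite addn0 !subrr nrm0.
  rewrite addnS; apply: le_trans (nrm_tri (u (m + k)%N) _ _) _.
  move: (u1 (m + k)%N) IH; rewrite exprS.
  have -> : (3 / 2) * (r * r ^+ (m + k)) = (1 / 2) * r ^+ (m + k).
    by rewrite mulrA; congr (_ * _); rewrite /r; field.
  by move: (r ^+ (m + k)) (r ^+ m) => a b; lra.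
have tail' m n : (m <= n)%N -> nrm (u n - u m) <= (3 / 2) * r ^+ m.
  move=> mn; rewrite -(subnKC mn); apply: le_trans (tail _ _) _.
  by move: (rn (m + (n - m))%N); move: (r ^+ m) (r ^+ (m + (n - m))) => a b; lra.
have [|x ux] := @cauchy_limit _ _ u.
  move=> e e0; have e3 : 0 < e / 3 by rewrite divr_gt0.
  have [N hN] := inv_succ_small e3; exists N => m n Nm Nn.
  apply: le_lt_trans (nrm_tri (u N) _ _) _.
  have := tail' _ _ Nm; have := tail' _ _ Nn.
  have := hN N (leqnn _); rewrite ltr_pdivlMr //; have := third_small N; rewrite -/r.
  rewrite [nrm (u N - u n)]nrmBC.
  move: (r ^+ N) N.+1%:R^-1 => a b. lra.
have ux' j : nrm (x - u j.+1) <= (1 / 2) * r ^+ j.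
  rewrite leNgt; apply/negP => lt.
  have [|N hN] := ux (nrm (x - u j.+1) - (1 / 2) * r ^+ j).
    by rewrite subr_gt0.
  have := hN _ (leq_maxl N j.+1); have := tail' _ _ (leq_maxr N j.+1).
  have := nrm_tri (u (maxn N j.+1)) x (u j.+1).
  rewrite [nrm (x - u (maxn _ _))]nrmBC exprS.
  have -> : (3 / 2) * (r * r ^+ j) = (1 / 2) * r ^+ j.
    by rewrite mulrA; congr (_ * _); rewrite /r; field.
  by move: lt; lra.
have [M [N hM]] := pb x.
have lower j : j%:R < nrm (ip x (h (nn j))).
  have := nrm_le_sub (ip (u j.+1) (h (nn j))) (ip x (h (nn j))).
  rewrite -(formBl hb) => h1.
  have h2 : nrm (ip (u j.+1 - x) (h (nn j))) <= (1 / 2) * r ^+ j * nrm (h (nn j)).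
    by apply: le_trans (ip_cauchy_schwarz _ _) _; rewrite ler_wpM2r ?nrm_ge0 // nrmBC.
  have h3 : 2 * j%:R < r ^+ j * nrm (h (nn j)).
    by move: (nnb j); rewrite ltr_pdivrMr // [X in _ < X]mulrC.
  move: h1 h2 h3 (u2 j); rewrite -mulrA.
  by move: (r ^+ j * nrm _) => a; lra.
pose j := maxn N (Num.bound `|M|).
have := hM (nn j) (leq_trans (leq_maxl _ _) (nnj j)).
apply/negP; rewrite -ltNge; apply: lt_trans (lower j).
apply: le_lt_trans (ler_norm M) _.
apply: lt_le_trans (archi_boundP (normr_ge0 M)) _.
by rewrite ler_nat leq_maxr.
Qed.

(** Hilbert spaces are weakly sequentially complete: the limit functional is
    bounded by [uniform_boundedness] and represented by [riesz]. *)
Lemma weak_limit (h : nat -> G) :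
  (forall x, exists L, limit_of (fun n => ip x (h n)) L) ->
  exists h0, forall x, limit_of (fun n => ip x (h n)) (ip x h0).
Proof.
move=> cv; pose F x := projT1 (cid (cv x)).
have FP x : limit_of (fun n => ip x (h n)) (F x) := projT2 (cid (cv x)).
have [|M [N hM]] := @uniform_boundedness h.
  move=> x; have [N hN] := FP x 1 ltr01; exists (nrm (F x) + 1), N => n Nn.
  apply: le_trans (nrm_le_sub _ (F x)) _; rewrite lerD2l ltW //.
  exact: hN.
have [|||h0 h0P] := @riesz _ _ ip hb ip_coercive F `|M|.
- move=> a x y; apply: limit_unique (FP _) _.
  have -> : (fun n => ip (a *: x + y) (h n)) = (fun n => a * ip x (h n) + ip y (h n)).
    by apply/funext => n; rewrite (formP hb).
  by apply: limitD => //; apply: limitM.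
- exact: normr_ge0.
- move=> x; rewrite leNgt; apply/negP => lt.
  have [|N' hN] := FP x (nrm (F x) - `|M| * nrm x); first by rewrite subr_gt0.
  have := hN _ (leq_maxr N N'); have := hM _ (leq_maxl N N').
  move=> h1 h2; have h3 := ip_cauchy_schwarz x (h (maxn N N')).
  have h4 : nrm x * nrm (h (maxn N N')) <= nrm x * `|M|.
    by rewrite ler_wpM2l ?nrm_ge0 //; apply: le_trans h1 (ler_norm _).
  have h5 := nrm_le_sub (F x) (ip x (h (maxn N N'))).
  move: h2 h3 h4 h5; rewrite nrmBC mulrC; lra.
by exists h0 => x; rewrite -h0P.
Qed.

Variable G1 : set G.
Hypothesis lin1 : linear_subspace G1.
Hypothesis cl1 : closed G1.

Local Notation G2 := (ortho_compl ip G1).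

Lemma ortho_compl_linear : linear_subspace G2.
Proof.
split=> [y _|a x y hx hy z Gz]; first by rewrite (form0l hb).
by rewrite (formP hb) hx // hy // mulr0 addr0.
Qed.

Lemma ortho_compl_disjoint x : G1 x -> G2 x -> x = 0.
Proof. by move=> x1 /(_ _ x1)/(coercive_eq0 ip_coercive). Qed.

Lemma ortho_decomposition x : exists a b, [/\ G1 a, G2 b & x = a + b].
Proof.
have [a a1 h] := projection_exists hb ip_coercive x lin1 cl1.
by exists a, (x - a); split=> //; rewrite addrC subrK.
Qed.

Lemma ortho_compl_compl x : (forall y, G2 y -> ip y x = 0) -> G1 x.
Proof.
have [a [b [a1 b2 ->]]] := ortho_decomposition x => h.
have /(coercive_eq0 ip_coercive) -> : ip b b = 0.
  by have := h b b2; rewrite (formDr hb) b2 // add0r.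
by rewrite addr0.
Qed.

Lemma E_map_sum a b c : G1 a -> G2 b -> E_map ip G1 (a + b, c) = (a, 'i *: b + c).
Proof.
move=> a1 b2; rewrite /E_map /=.
rewrite (proj_alongE lin1 ortho_compl_linear ortho_compl_disjoint) //.
rewrite [a + b]addrC (proj_alongE ortho_compl_linear lin1) //.
by move=> x x2 x1; apply: ortho_compl_disjoint.
Qed.

Lemma E_map_inj l l' : G1 l.2 -> G1 l'.2 -> E_map ip G1 l = E_map ip G1 l' -> l = l'.
Proof.
case: l l' => [x c] [x' c'] /= c1 c1'.
have [a [b [a1 b2 ->]]] := ortho_decomposition x.
have [a' [b' [a1' b2' ->]]] := ortho_decomposition x'.
rewrite !E_map_sum // => -[-> /eqP].
rewrite -subr_eq0 opprD addrACA -scalerBr => /eqP h.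
have bb : b - b' = 0.
  apply: ortho_compl_disjoint; last exact: (subspaceB ortho_compl_linear).
  have -> : b - b' = 'i *: (c - c').
    have := congr1 (fun z => (- 'i) *: z) h.
    rewrite scalerDr scalerA mulNr -expr2 sqrCi opprK scale1r scaler0 scaleNr => /eqP.
    by rewrite subr_eq0 => /eqP.
  by apply: (subspaceZ lin1); apply: (subspaceB lin1).
move: h; rewrite bb scaler0 add0r => /eqP; rewrite subr_eq0 => /eqP ->.
by move/eqP: bb; rewrite subr_eq0 => /eqP ->.
Qed.
End HilbertSpace.

(** * Boundary triples *)

Section Sector.
Context {R : realType}.

(** The part of the two half-planes beyond height [r] in the first and third
    quadrants.  It contains no two conjugate points, so that Green's identity
    determines the inner products of all defect vectors over it. *)
Definition sector (r : R) : set R[i] :=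
  [set l | r < `|Im l| /\ 0 < Re l * Im l].

Lemma sector_ample r : 0 <= r -> ample (sector r).
Proof.
move=> r0; split=> [l [rl _]|l [rl p] d d0|m m0].
- by rewrite -normr_gt0; apply: le_lt_trans rl.
- have x0 : Re l != 0 by apply: contraTneq p => ->; rewrite mul0r ltxx.
  have ax : 0 < `|Re l| by rewrite normr_gt0.
  pose t := d / (2 * `|Re l|); have t0 : 0 < t by rewrite divr_gt0 // mulr_gt0.
  exists (l + (t * Re l)%:C%C).
    split; first by rewrite ImD /= addr0.
    rewrite !ReImE /= addr0 -[X in X + _]mul1r -mulrDl -mulrA mulr_gt0 //.
    by rewrite addr_gt0.
  split.
    rewrite -subr_eq0 addrC addKr; apply/eqP => /(congr1 (@complex.Re R)) /= /eqP.
    by rewrite mulf_eq0 (negPf x0) orbF gt_eqF.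
  rewrite addrC addKr nrm_real normrM gtr0_norm //.
  have -> : t * `|Re l| = d / 2 by rewrite /t; field; rewrite gt_eqF.
  by lra.
have [p|p] := ltP 0 (Im m).
  exists (Complex 1 (r + 1)).
    split=> /=; first by rewrite ger0_norm ?ltrDl // addr_ge0.
    by rewrite mul1r ltr_wpDl.
  by rewrite /= mulr_gt0 // ltr_wpDl.
exists (Complex (-1) (- (r + 1))).
  split=> /=; first by rewrite normrN ger0_norm ?ltrDl // addr_ge0.
  by rewrite mulrNN mul1r ltr_wpDl.
rewrite /= nmulr_rgt0 ?oppr_lt0 ?ltr_wpDl //.
by rewrite lt_neqAle m0.
Qed.

Lemma sector_conj_neq r l m : sector r l -> sector r m -> (m^*)%C - l != 0.
Proof.
move=> [_ l0] [_ m0]; rewrite subr_eq0; apply: contraTneq l0 => <-.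
by rewrite ReJ ImJ mulrN oppr_gt0 -leNgt ltW.
Qed.
End Sector.

Section BoundaryTriple.
Context {R : realType} {V G : completeNormedModType R[i]}.
Variables (f : {hermitian V for false & Num.conj}) (ip : {dot G for Num.conj}).
Variables (G1 : set G) (A : set (V * V)) (GB : set ((V * V) * (G * G))).
Hypothesis hA : simple_symmetric f A.
Hypothesis hip : hilbert_ip ip.
Hypotheses (lin1 : linear_subspace G1) (cl1 : closed G1).
Hypothesis hGB : D_boundary_triple f ip G1 A GB.

Let hb : bounded_form f := pontryagin_bounded (ss_pontryagin hA).
Local Notation E := (E_map ip G1).

Lemma GB_ran l : G1 l.2 -> exists x, GB (x, l).
Proof.
move=> l1; have : rel_ran GB l by rewrite (bt_ranB hGB).
by move=> [[x l'] h /= <-]; exists x.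
Qed.

Lemma GB_ranP x l : GB (x, l) -> G1 l.2.
Proof.
move=> h; have : rel_ran GB l by exists (x, l).
by rewrite (bt_ranB hGB).
Qed.

Lemma GB_sub x y x' y' l m : GB ((x, y), l) -> GB ((x', y'), m) ->
  GB ((x - x', y - y'), l - m).
Proof.
exact: (@subspaceB _ _ _ (bt_opB hGB).1 ((x, y), l) ((x', y'), m)).
Qed.

Lemma GB_add x y x' y' l m : GB ((x, y), l) -> GB ((x', y'), m) ->
  GB ((x + x', y + y'), l + m).
Proof.
exact: (@subspaceD _ _ _ (bt_opB hGB).1 ((x, y), l) ((x', y'), m)).
Qed.

Lemma GB_green x l y k : GB (x, l) -> GB (y, k) -> green_identity f ip x l y (E k).
Proof. by move=> h1 h2; apply: (bt_green hGB) h1 _; exists (y, k). Qed.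

Lemma GB_adj x l : GB (x, l) -> rel_adj f A x.
Proof.
by move=> h; rewrite -(bt_domB hGB); apply: subset_closure; exists (x, l).
Qed.

Lemma green_conj l x y : form_Gamma f (x, l *: x) y = 0 <-> f x y.2 = l * f x y.1.
Proof.
rewrite /form_Gamma /= (formZl hb) -mulrBr; split=> [/eqP|->].
  by rewrite mulf_eq0 (negPf (neq0Ci _)) /= subr_eq0 => /eqP.
by rewrite subrr mulr0.
Qed.

Lemma adj_form u y : A u -> rel_adj f A y -> form_Gamma f y u = 0.
Proof.
case: u => u v Au /(_ _ _ Au) h; rewrite /form_Gamma /= -mulrBr.
by rewrite (formC hb v y.1) -h -(formC hb) subrr mulr0.
Qed.

(** A reformulation of [defect_orthogonal] in terms of the form in Green's identity. *)
Lemma defect_form L y : ample L ->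
  (forall l x, L l -> rel_adj f A (x, l *: x) -> form_Gamma f (x, l *: x) y = 0) ->
  A y.
Proof.
move=> aL h; have -> : y = (y.1, y.2) by case: y {h}.
apply: (defect_orthogonal hA aL) => l x Ll Kx.
exact/green_conj/h.
Qed.

Lemma form_Gamma_limit (u : V * V) (y : nat -> V * V) z :
  limit_of (fun n => (y n).1) z.1 -> limit_of (fun n => (y n).2) z.2 ->
  limit_of (fun n => form_Gamma f u (y n)) (form_Gamma f u z).
Proof.
move=> h1 h2; rewrite /form_Gamma -mulNr.
have -> : (fun n => 'i * f u.1 (y n).2 - 'i * f u.2 (y n).1) =
          (fun n => 'i * f u.1 (y n).2 + (- 'i) * f u.2 (y n).1).
  by apply/funext => n; rewrite mulNr.
by apply: limitD; apply: limitM; apply: limit_form.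
Qed.

Lemma closure_limit (S : set (V * V)) x : closure (S : set (V * V)%type) x ->
  exists y : nat -> V * V, [/\ forall n, S (y n),
    limit_of (fun n => (y n).1) x.1 & limit_of (fun n => (y n).2) x.2].
Proof.
move=> /closure_approx2 h.
have d0 n : 0 < n.+1%:R^-1 :> R by rewrite invr_gt0 ltr0n.
pose y n := s2val (cid2 (h _ (d0 n))).
have yS n : S (y n) := s2valP (cid2 (h _ (d0 n))).
have yd n : nrm (x.1 - (y n).1) < n.+1%:R^-1 /\ nrm (x.2 - (y n).2) < n.+1%:R^-1.
  exact: (s2valP' (cid2 (h _ (d0 n)))).
exists y; split=> // e /inv_succ_small[N hN]; exists N => n /hN hn;
  rewrite nrmBC; apply: lt_trans hn; by case: (yd n).
Qed.

(** By Green's identity the kernel of the boundary operator is orthogonal to the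
    domain of its partner, which is dense in the adjoint; the orthogonal companion
    of the adjoint is [A].  The converse is the maximality of the partner. *)
Lemma GB_ker x : GB (x, 0) <-> A x.
Proof.
split=> [h|Ax].
  apply: (defect_form (sector_ample (lexx 0))) => l y _ Ky.
  move: Ky; rewrite -(bt_domA hGB) => /closure_limit[u [uD u1 u2]].
  have lim : forall z, limit_of (fun n => form_Gamma f x (u n)) z -> z = 0.
    move=> z hz; apply: limit_unique hz _.
    have -> : (fun n => form_Gamma f x (u n)) = fun=> 0; last exact: limit_cst.
    apply/funext => n; have [[w k] hw /= wu] := uD n.
    rewrite -wu; have := bt_green hGB h hw; rewrite /green_identity /= => ->.
    by rewrite !(form0l (ip_hermitian ip)) !mulr0 subrr.
  have {lim}h0 : form_Gamma f x (y, l *: y) = 0 by apply/lim/form_Gamma_limit.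
  apply/green_conj => /=; move: h0; rewrite /form_Gamma /= -mulrBr => /eqP.
  rewrite mulf_eq0 (negPf (neq0Ci _)) /= subr_eq0 (formZr hb) => /eqP e.
  by rewrite (formC hb x.2 y) -e rmorphM /= conjcK -(formC hb).
have [[x' l] h /pair_equal_spec[xx El]] : [set (p.1, E_map ip G1 p.2) | p in GB] (x, 0).
  apply: (bt_determined hGB); first exact: (subspace0 lin1).
  move=> u l /GB_adj adju; rewrite /green_identity /=.
  by rewrite !(form0r (ip_hermitian ip)) !mulr0 subrr adj_form.
rewrite -xx; suff <- : l = 0 by [].
apply: (E_map_inj hip lin1 cl1); first exact: GB_ranP h.
  exact: (subspace0 lin1).
have := @E_map_sum _ _ _ hip _ lin1 0 0 0 (subspace0 lin1) (subspace0 (ortho_compl_linear hip G1)).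
by rewrite scaler0 !addr0 => E0; rewrite [LHS]El -[LHS]E0.
Qed.

Lemma GB_determined y h : G1 h.1 ->
  (forall x l, GB (x, l) -> green_identity f ip x l y h) -> exists l, GB (y, l).
Proof.
move=> h1 gr; have [[y' l] hy [/= <- _]] := bt_determined hGB h1 gr.
by exists l.
Qed.

(** Let [y n] in the domain converge to [x] in its closure.  Since the boundary
    operator is onto, Green's identity shows that the boundary values of [y n]
    converge weakly, and their weak limit satisfies the identity that
    characterizes the boundary value of [x]. *)
Lemma GB_total x : rel_adj f A x -> exists l, GB (x, l).
Proof.
have hi := ip_hermitian ip.
rewrite -(bt_domA hGB) => /closure_limit[y [yD y1 y2]].
have ex n : exists h, [set (p.1, E p.2) | p in GB] (y n, h).
  by have [[w h] hw /= wy] := yD n; exists h; rewrite -wy.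
pose h n := projT1 (cid (ex n)).
have hP n : [set (p.1, E p.2) | p in GB] (y n, h n) := projT2 (cid (ex n)).
have h1 n : G1 (h n).1.
  have : rel_ran [set (p.1, E p.2) | p in GB] (h n) by exists (y n, h n).
  by rewrite (bt_ranA hGB).
have gr n u l : GB (u, l) ->
  form_Gamma f u (y n) = 'i * ip l.1 (h n).2 - 'i * ip l.2 (h n).1.
  by move=> hu; apply: (bt_green hGB hu (hP n)).
(* Green's identity at boundary values [(a, 0)] and [(0, b)] isolates the two components *)
have ii : - 'i * 'i = 1 :> R[i] by rewrite mulNr -expr2 sqrCi opprK.
have [k2 k2P] : exists k, forall a, limit_of (fun n => ip a (h n).2) (ip a k).
  apply: (weak_limit hip) => a.
  have [u hu] : exists u, GB (u, (a, 0)) by apply: GB_ran; exact: (subspace0 lin1).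
  exists (- 'i * form_Gamma f u x).
  have -> : (fun n => ip a (h n).2) = fun n => - 'i * form_Gamma f u (y n).
    by apply/funext => n; rewrite (gr _ _ _ hu) /= (form0l hi) mulr0 subr0 mulrA ii mul1r.
  by apply: limitM; apply: form_Gamma_limit.
have [k1 k1P] : exists k, forall a, limit_of (fun n => ip a (h n).1) (ip a k).
  apply: (weak_limit hip) => a.
  have [b [c [b1 c2 ->]]] := ortho_decomposition hip lin1 cl1 a.
  have [u hu] : exists u, GB (u, (0, b)) by apply: GB_ran.
  exists ('i * form_Gamma f u x).
  have -> : (fun n => ip (b + c) (h n).1) = fun n => 'i * form_Gamma f u (y n).
    apply/funext => n; rewrite (gr _ _ _ hu) /= (form0l hi) mulr0 sub0r mulrN mulrA.
    by rewrite -mulNr -mulNr ii mul1r (formDl hi) c2 // addr0.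
  by apply: limitM; apply: form_Gamma_limit.
apply: (@GB_determined x (k1, k2)) => [|u l hu] /=.
  apply: (ortho_compl_compl hip lin1 cl1) => c c2.
  apply: limit_unique (k1P c) _.
  have -> : (fun n => ip c (h n).1) = fun=> 0; last exact: limit_cst.
  by apply/funext => n; apply: c2.
rewrite /green_identity /=; apply: limit_unique.
  exact: (@form_Gamma_limit u y x).
have -> : (fun n => form_Gamma f u (y n)) =
          (fun n => 'i * ip l.1 (h n).2 + (- 'i) * ip l.2 (h n).1).
  by apply/funext => n; rewrite (gr _ _ _ hu) mulNr.
by rewrite -mulNr; apply: limitD; apply: limitM.
Qed.

(** The Weyl family at [l^*] is determined by the one at [l]: at conjugate points
    the left side of Green's identity vanishes.  Conversely, given a [k] with this
    orthogonality, lift it to some [(y, y')]; then [y' - l^* y] is orthogonal to the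
    defect space at [l], so [A] has an element [(a, l^* a + y' - l^* y)].  As [A] is
    the kernel of the boundary operator, it may be subtracted from the lift, which
    puts the lift on [l^* I]. *)
Lemma weyl_conj l k : Im l != 0 -> G1 k.2 ->
  weyl_family GB (l^*)%C k <->
  forall m, weyl_family GB l m -> ip m.1 (E k).2 = ip m.2 (E k).1.
Proof.
have hi := ip_hermitian ip.
move=> l0 k1; split=> [[_ [y _ <-] hy] m [_ [x _ <-] hx]|h].
  have := GB_green hx hy; rewrite /green_identity.
  have -> : form_Gamma f (x, l *: x) (y, (l^*)%C *: y) = 0.
    by apply/green_conj; rewrite /= (formZr hb) conjcK.
  move=> /esym/eqP; rewrite -mulrBr mulf_eq0 (negPf (neq0Ci _)) /= subr_eq0.
  by move/eqP.
have [[y y'] hy] := GB_ran k1.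
have l0' : Im (l^*)%C != 0 by rewrite ImJ oppr_eq0.
have [a Aa] : ran_shift A (l^*)%C (y' - (l^*)%C *: y).
  apply/(ran_shiftP hA _ l0') => x; rewrite conjcK => Kx.
  apply: (form_eq0_sym hb); have [m hm] := GB_total Kx.
  have := GB_green hm hy; rewrite /green_identity h; last first.
    by exists (x, l *: x) => //; exists x.
  rewrite subrr => /green_conj /= e.
  by rewrite (formBr hb) (formZr hb) conjcK e subrr.
exists (y - a, (l^*)%C *: (y - a)); first by exists (y - a).
have := GB_sub hy (proj2 (GB_ker _) Aa); rewrite subr0.
by rewrite opprD opprB addrA [y' + _]addrC subrK scalerBr.
Qed.

End BoundaryTriple.

(** * Isometric relations between Pontryagin spaces *)

Section IsometricRelation.
Context {R : realType} {V V' : completeNormedModType R[i]}.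
Variables (f : V -> V -> R[i]) (f' : V' -> V' -> R[i]) (W : set (V * V')).

Record total_isometry : Prop := {
  ti_form : pontryagin_form f;
  ti_form' : pontryagin_form f';
  ti_linear : linear_subspace (W : set (V * V')%type);
  ti_closed : closed (W : set (V * V')%type);
  ti_isometric : forall p q, W p -> W q -> f p.1 q.1 = f' p.2 q.2;
  ti_dom : forall z, (forall p, W p -> f z p.1 = 0) -> z = 0;
  ti_ran : forall z, (forall p, W p -> f' z p.2 = 0) -> z = 0
}.
End IsometricRelation.

Section TotalIsometry.
Context {R : realType}.

Lemma swap_closed (V V' : normedModType R[i]) (W : set (V * V')) :
  closed (W : set (V * V')%type) ->
  closed ([set p | W (p.2, p.1)] : set (V' * V)%type).
Proof.
move=> /closed_approx2 cW; apply/closed_approx2 => p h; apply: cW => e e0.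
by have [q Wq [? ?]] := h e e0; exists (q.2, q.1).
Qed.

Variables (V V' : completeNormedModType R[i]).
Variables (f : V -> V -> R[i]) (f' : V' -> V' -> R[i]) (W : set (V * V')).
Hypothesis hW : total_isometry f f' W.

Lemma total_isometry_swap : total_isometry f' f [set p | W (p.2, p.1)].
Proof.
case: hW => hf hf' lin cl iso dom ran; split=> //.
- split=> [|a x y]; first exact: (subspace0 lin).
  exact: (lin.2 a (x.2, x.1) (y.2, y.1)).
- exact: swap_closed.
- by move=> p q Wp Wq; rewrite (iso _ _ Wp Wq).
- by move=> z h; apply: ran => p Wp; apply: (h (p.2, p.1)); case: p Wp.
- by move=> z h; apply: dom => p Wp; apply: (h (p.2, p.1)); case: p Wp.
Qed.

(** The relation is single-valued because its range is total, and it is bounded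
    where [f'] is positive because it preserves the forms; finitely many dimensions
    are left. *)
Lemma total_isometry_bounded : exists2 C : R, 0 <= C &
  forall x x', W (x, x') -> nrm x' <= C * nrm x.
Proof.
case: total_isometry_swap => hf' hf lin cl iso dom ran.
have [k [e [c c0 hc]]] := pontryagin_index hf'.
have [K K0 hK] := form_bounded hf.
have [||C C0 hC] := @bounded_below_codim _ V' V f' hf' [seq e i | i <- enum 'I_k]
    [set p | W (p.2, p.1)] lin cl.
- move=> x' Wx; apply: dom => p Wp; rewrite (iso _ _ Wx Wp) /=.
  exact: (form0l hf).
- have q0 : 0 <= K / c by rewrite divr_ge0 // ltW.
  exists (K / c + 1); first by rewrite addr_ge0.
  move=> x' x Wx h; have {}hc : c * nrm x' ^+ 2 <= Re (f' x' x').
    by apply: hc => i; apply: h; apply: map_f; rewrite mem_enum.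
  rewrite -ler_sqr ?nnegrE ?nrm_ge0 ?mulr_ge0 ?addr_ge0 ?nrm_ge0 //.
  have h1 : nrm x' ^+ 2 <= K / c * nrm x ^+ 2.
    rewrite mulrAC ler_pdivlMr // mulrC; apply: le_trans hc _.
    rewrite (iso _ _ Wx Wx) /=; apply: le_trans (Re_le _) _.
    by rewrite expr2 mulrA; apply: hK.
  apply: le_trans h1 _; rewrite exprMn ler_wpM2r ?sqr_ge0 //.
  by move: q0; move: (K / c) => t t0; nra.
by exists C => // x x' h; apply: (hC x' x).
Qed.

(** Its domain is closed by boundedness and total, hence everything. *)
Lemma total_isometry_total x : exists x', W (x, x').
Proof.
have [C C0 hC] := total_isometry_bounded.
have [hf' hf lin cl _ _ ran] := total_isometry_swap.
pose D := [set x | exists x', W (x, x')].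
have clD : closed D by apply: (closed_range lin cl C0) => x' y; apply: hC.
have linD : linear_subspace D.
  split=> [|a u v [u' hu] [v' hv]]; first by exists 0; exact: (subspace0 lin).
  by exists (a *: u' + v'); exact: (lin.2 a (u', u) (v', v)).
apply: contrapT => nD; have [y hy fxy] := separation hf linD clD nD.
apply: fxy; have -> : y = 0; last exact: (form0r hf).
apply: ran => p Wp; apply: (form_eq0_sym hf); apply: hy.
by exists p.1.
Qed.

Lemma total_isometry_functional x a b : W (x, a) -> W (x, b) -> a = b.
Proof.
have [C C0 hC] := total_isometry_bounded.
move=> ha hb; apply/eqP; rewrite -subr_eq0; apply/eqP/nrm_eq0/eqP.
rewrite eq_le nrm_ge0 andbT.
have /hC : W (x - x, a - b) := @subspaceB _ _ _ (ti_linear hW) (x, a) (x, b) ha hb.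
by rewrite subrr nrm0 mulr0.
Qed.
End TotalIsometry.

Section UnitaryExtension.
Context {R : realType} {V V' : completeNormedModType R[i]}.
Variables (f : V -> V -> R[i]) (f' : V' -> V' -> R[i]) (W0 : set (V * V')).
Hypotheses (hf : pontryagin_form f) (hf' : pontryagin_form f').
Hypothesis iso0 : forall p q, W0 p -> W0 q -> f p.1 q.1 = f' p.2 q.2.
Hypothesis dom0 : forall z, (forall p, W0 p -> f z p.1 = 0) -> z = 0.
Hypothesis ran0 : forall z, (forall p, W0 p -> f' z p.2 = 0) -> z = 0.

(** The closed linear hull, as an intersection: closed linear conditions on pairs
    then pass from [W0] to its hull. *)
Definition closed_hull : set (V * V') := [set p | forall S : set (V * V'),
  linear_subspace (S : set (V * V')%type) -> closed (S : set (V * V')%type) ->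
  W0 `<=` S -> S p].

Lemma isometric_to_subspace (q : V * V') :
  linear_subspace ([set p | f p.1 q.1 = f' p.2 q.2] : set (V * V')%type) /\
  closed ([set p | f p.1 q.1 = f' p.2 q.2] : set (V * V')%type).
Proof.
split.
  split=> [|a x y /= hx hy]; first by rewrite /= (form0l hf) (form0l hf').
  by rewrite (formP hf) (formP hf') hx hy.
apply/closed_approx2 => p h; apply/eqP; rewrite -subr_eq0; apply/eqP.
have [K K0 hK] := form_bounded hf; have [K' K0' hK'] := form_bounded hf'.
apply: (@small_eq0 _ _ _ (K * nrm q.1 + K' * nrm q.2)) => e e0.
have [s /= hs [s1 s2]] := h e e0.
apply: le_trans (nrm_tri (f s.1 q.1) _ _) _; rewrite mulrDl; apply: lerD.
  exact: (form_near hf).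
by rewrite hs nrmBC; apply: (form_near hf').
Qed.

Lemma closed_hull_isometry : total_isometry f f' closed_hull.
Proof.
have sub : W0 `<=` closed_hull by move=> p Wp S _ _; apply.
split=> //.
- split=> [S linS _ _|a x y hx hy S linS clS hS]; first exact: (subspace0 linS).
  by apply: linS.2; [apply: hx|apply: hy].
- apply/closed_approx2 => p h S linS clS hS.
  move/closed_approx2: (clS); apply => e e0.
  by have [q hq ?] := h e e0; exists q => //; apply: hq.
- have half p q : closed_hull p -> W0 q -> f p.1 q.1 = f' p.2 q.2.
    move=> hp Wq; have [lin cl] := isometric_to_subspace q.
    by apply: (hp _ lin cl) => s Ws; apply: iso0.
  move=> p q hp hq; have [lin cl] := isometric_to_subspace p.
  have /= e : f q.1 p.1 = f' q.2 p.2.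
    apply: (hq _ lin cl) => s Ws /=.
    by rewrite (formC hf p.1) (formC hf' p.2) (half p s).
  by rewrite (formC hf q.1) (formC hf' q.2) e.
- by move=> z h; apply: dom0 => p /sub; apply: h.
- by move=> z h; apply: ran0 => p /sub; apply: h.
Qed.

(** An isometry between total subsets extends to a bounded unitary operator, as
    in Hilbert spaces; the indefiniteness is absorbed by [total_isometry_bounded]. *)
Lemma unitary_extension : exists (U : {linear V -> V'}) (U' : {linear V' -> V}),
  [/\ cancel U U', cancel U' U,
      exists C : R, forall x, nrm (U x) <= C * nrm x,
      forall x y, f' (U x) (U y) = f x y &
      forall p, W0 p -> U p.1 = p.2].
Proof.
have hW := closed_hull_isometry.
have mk (X Y : completeNormedModType R[i]) (g : X -> X -> R[i]) (g' : Y -> Y -> R[i])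
    (T : set (X * Y)) : total_isometry g g' T ->
    exists U : {linear X -> Y}, forall x, T (x, U x).
  move=> hT; pose U x := projT1 (cid (total_isometry_total hT x)).
  have UP x : T (x, U x) := projT2 (cid (total_isometry_total hT x)).
  have Ulin : linear U.
    move=> a x y; apply: (total_isometry_functional hT (UP _)).
    exact: ((ti_linear hT).2 a (x, U x) (y, U y)).
  by exists (HB.pack U (GRing.isLinear.Build _ _ _ _ U Ulin) : {linear X -> Y}).
have [U UP] := mk _ _ _ _ _ hW.
have hW' := total_isometry_swap hW.
have [U' UP'] := mk _ _ _ _ _ hW'.
exists U, U'; split.
- by move=> x; apply: (total_isometry_functional hW' (UP' _)); apply: UP.
- by move=> x; apply: (total_isometry_functional hW (UP _)); apply: UP'.
- by have [C _ hC] := total_isometry_bounded hW; exists C => x; exact: hC (UP x).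
- by move=> x y; rewrite (ti_isometric hW (UP x) (UP y)).
- move=> [x x'] Wx /=; apply: (total_isometry_functional hW (UP x)).
  by move=> S _ _; apply.
Qed.
End UnitaryExtension.

(** * Simple operators of class (LP) *)

Section SimpleLP.
Context {R : realType} {V : completeNormedModType R[i]}.
Variables (f : {hermitian V for false & Num.conj}) (k : nat) (t0 : R).
Variables (Hm Hp : set V) (A : set (V * V)) (Ga : set R[i]).
Hypotheses (PA : class_P f A) (GaA : Gamma_set f k t0 Hm Hp A Ga).
Hypothesis simpleA : simple_LP f A Ga.

Let hf : pontryagin_form f := canonical_pontryagin (Ga_decomposition GaA).

Lemma simple_LP_total z :
  (forall l x, Ga l -> rel_adj f A (x, l *: x) -> f z x = 0) -> z = 0.
Proof.
move=> h; apply: (nondegenerate hf) => y; apply: (form_eq0_sym hf).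
have : closed_lin_span (\bigcup_(l in Ga) Ker_at l (rel_adj f A)) y.
  by rewrite simpleA.
move=> /closure_approx; apply: (form_closure0 hf) => s [n [c [v [hv ->]]]].
rewrite linear_sumlz big1 // => i _; apply: etrans (formZl hf _ _ _) _.
have [l Gl Kv] := hv i; rewrite (form_eq0_sym hf) ?mulr0 //.
exact: h Gl Kv.
Qed.

Lemma symmetric_dissipative : pi_dissipative f A /\ pi_dissipative f (rel_opp A).
Proof.
have [linA symA] := P_symmetric PA.
have im x y : A (x, y) -> Im (f y x) = 0 := sym_diag_real symA.
split; split=> //.
- by move=> x y /im ->.
- split=> [|a x y Ax Ay]; rewrite /rel_opp /=; first by rewrite oppr0; exact: linA.1.
  rewrite opprD -scalerN.
  exact: (linA.2 a (x.1, - x.2) (y.1, - y.2)).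
- by move=> x y /im; rewrite (formNl hf) ImN => /eqP; rewrite oppr_eq0 => /eqP ->.
Qed.

(** An eigenvalue in [Ga] contradicts the regularity, at it or at its opposite, of
    the dissipative operators [A] and [- A].  An eigenvector for another eigenvalue is orthogonal to
    the defect spaces over [Ga], since [Ga] is closed under conjugation, and
    vanishes by simplicity. *)
Lemma simple_LP_simple_symmetric : simple_symmetric f A.
Proof.
have [linA symA] := P_symmetric PA; have [disA disA'] := symmetric_dissipative.
split=> //; first exact: P_closed PA.
- move=> l x l0 Ax; have [Gl|Gl] := pselect (Ga l).
    have [p|p] := ltP (Im l) 0.
      have [Kl _] := Ga_regular GaA disA (fun _ h => h) (conj Gl p).
      suff : [set 0] x by [].
      by rewrite -Kl.
    have Gl' : Ga (- l) by rewrite -(Ga_opp GaA); exists l.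
    have p' : Im (- l) < 0 by rewrite ImN oppr_lt0 lt_neqAle eq_sym l0.
    have [Kl _] := Ga_regular_opp GaA disA' (fun _ h => h) (conj Gl' p').
    suff : [set 0] x by [].
    by rewrite -Kl /Ker_at /rel_opp /= scaleNr opprK.
  apply: simple_LP_total => m y Gm Ky.
  have := Ky _ _ Ax; rewrite /= (formZl hf) (formZr hf) => /eqP.
  rewrite -subr_eq0 -mulrBl mulf_eq0 subr_eq0 => /orP[/eqP ml|/eqP //].
  by case: Gl; rewrite -ml -(Ga_conj GaA); exists m.
- by move=> z h; apply: simple_LP_total => l x Gl; apply: h; apply: (Ga_nonreal GaA).
Qed.
End SimpleLP.

(** * Unitary equivalence of boundary triples *)

Section UnitaryEquivalence.
Context {R : realType} {V V' G : completeNormedModType R[i]}.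
Variables (f : {hermitian V for false & Num.conj}) (f' : {hermitian V' for false & Num.conj}).
Variables (ip : {dot G for Num.conj}) (G1 : set G).
Variables (A : set (V * V)) (A' : set (V' * V')).
Variables (GB : set ((V * V) * (G * G))) (GB' : set ((V' * V') * (G * G))).
Hypotheses (hA : simple_symmetric f A) (hA' : simple_symmetric f' A').
Hypotheses (hip : hilbert_ip ip) (lin1 : linear_subspace G1) (cl1 : closed G1).
Hypotheses (hGB : D_boundary_triple f ip G1 A GB).
Hypotheses (hGB' : D_boundary_triple f' ip G1 A' GB').

Let hb := pontryagin_bounded (ss_pontryagin hA).
Let hb' := pontryagin_bounded (ss_pontryagin hA').

(** Over a point where the two Weyl families agree, each defect vector on one side
    has a partner on the other. *)
Definition same_boundary_values L : set (V * V') := [set p | exists l m,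
  [/\ L l, GB ((p.1, l *: p.1), m) & GB' ((p.2, l *: p.2), m)]].

Lemma weyl_family_defect l m : weyl_family GB l m <-> exists x, GB ((x, l *: x), m).
Proof.
split=> [[_ [x _ <-] h]|[x h]]; first by exists x.
by exists (x, l *: x) => //; exists x.
Qed.

Lemma same_boundary_values_isometric r p q :
  same_boundary_values (sector r) p -> same_boundary_values (sector r) q ->
  f p.1 q.1 = f' p.2 q.2.
Proof.
move=> [l [m [Ll p1 p2]]] [l' [m' [Ll' q1 q2]]].
have := GB_green hGB p1 q1; have := GB_green hGB' p2 q2.
rewrite /green_identity => <-; rewrite /form_Gamma /=.
rewrite !(formZl hb) !(formZr hb) !(formZl hb') !(formZr hb') -!mulrBr -!mulrBl.
move=> /(mulfI (neq0Ci _)).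
exact/mulfI/sector_conj_neq/Ll'.
Qed.

(** Lift the boundary value [l] of [x] to some [a] in the domain of [GB'].  The images
    of defect elements cannot distinguish [U x] from [a] in Green's identity, so
    their difference is in [A'], the kernel of [GB']. *)
Lemma transport (U : {linear V -> V'}) L : ample L ->
  (forall x y, f' (U x) (U y) = f x y) ->
  (forall l x' m, L l -> GB' ((x', l *: x'), m) ->
     exists2 x, GB ((x, l *: x), m) & U x = x') ->
  forall x l, GB (x, l) -> GB' ((U x.1, U x.2), l).
Proof.
move=> aL iso lift [x y] l hx /=.
have [[a b] ha] := GB_ran hGB' (GB_ranP hGB hx).
have Ad : A' (U x - a, U y - b).
  apply: (defect_form hA' aL) => m u' Lm Ku.
  have [k hk] := GB_total hA' hip lin1 cl1 hGB' Ku.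
  have [u hu Uu] := lift _ _ _ Lm hk.
  have e1 := GB_green hGB' hk ha; have := GB_green hGB hu hx.
  rewrite /green_identity -e1 /form_Gamma /= -Uu.
  rewrite !(formBr hb') -linearZ !iso => /eqP.
  by rewrite -subr_eq0 => /eqP <-; ring.
have := GB_add hGB' (proj2 (GB_ker hA' hip lin1 cl1 hGB' _) Ad) ha.
by rewrite !subrK add0r.
Qed.
End UnitaryEquivalence.

Section WeylDeterminesSectors.
Context {R : realType} {V V' G : completeNormedModType R[i]}.
Variables (f : {hermitian V for false & Num.conj}) (f' : {hermitian V' for false & Num.conj}).
Variables (ip : {dot G for Num.conj}) (G1 : set G).
Variables (A : set (V * V)) (A' : set (V' * V')).
Variables (GB : set ((V * V) * (G * G))) (GB' : set ((V' * V') * (G * G))).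
Hypotheses (hA : simple_symmetric f A) (hA' : simple_symmetric f' A').
Hypotheses (hip : hilbert_ip ip) (lin1 : linear_subspace G1) (cl1 : closed G1).
Hypotheses (hGB : D_boundary_triple f ip G1 A GB).
Hypotheses (hGB' : D_boundary_triple f' ip G1 A' GB').

Lemma weyl_family_conj_eq l : Im l != 0 -> weyl_family GB l = weyl_family GB' l ->
  weyl_family GB (l^*)%C = weyl_family GB' (l^*)%C.
Proof.
move=> l0 e; apply/seteqP; split=> k hk.
  have k1 : G1 k.2 by case: hk => x _; apply: (GB_ranP hGB).
  apply/(weyl_conj hA' hip lin1 cl1 hGB' l0 k1) => m; rewrite -e.
  exact: (proj1 (weyl_conj hA hip lin1 cl1 hGB l0 k1) hk).
have k1 : G1 k.2 by case: hk => x _; apply: (GB_ranP hGB').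
apply/(weyl_conj hA hip lin1 cl1 hGB l0 k1) => m; rewrite e.
exact: (proj1 (weyl_conj hA' hip lin1 cl1 hGB' l0 k1) hk).
Qed.

Lemma sector_lift r l x' m : 0 <= r ->
  (forall l : R[i], r < `|Im l| -> weyl_family GB l = weyl_family GB' l) ->
  sector r l -> GB' ((x', l *: x'), m) ->
  exists x, GB ((x, l *: x), m) /\ same_boundary_values GB GB' (sector r) (x, x').
Proof.
move=> r0 e sl h; have : weyl_family GB' l m by apply/weyl_family_defect; exists x'.
rewrite -e; last by case: sl.
by move=> /weyl_family_defect[x hx]; exists x; split=> //; exists l, m.
Qed.

Lemma same_boundary_values_total r z : 0 <= r ->
  (forall l : R[i], r < `|Im l| -> weyl_family GB l = weyl_family GB' l) ->
  (forall p, same_boundary_values GB GB' (sector r) p -> f' z p.2 = 0) -> z = 0.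
Proof.
move=> r0 e h; apply: (defect_total hA' (sector_ample r0)) => l x' sl Kx'.
have [m hm] := GB_total hA' hip lin1 cl1 hGB' Kx'.
by have [x [_ /h]] := sector_lift r0 e sl hm.
Qed.
End WeylDeterminesSectors.

Theorem corollary5p9 (R : realType) (k : nat)
  (* the universal constant t0 of the sets Gamma_A, equal to 1.84 to two decimals *)
  (t0 : R) (ht0 : 1835 / 1000 <= t0 < 1845 / 1000)
  (* the Pontryagin spaces *)
  (H H' : completeNormedModType R[i])
  (f : {hermitian H for false & Num.conj})
  (f' : {hermitian H' for false & Num.conj})
  (sepH : separable H) (sepH' : separable H')
  (pontH : pontryagin_space f k) (pontH' : pontryagin_space f' k)
  (* the operators *)
  (A : set (H * H)) (A' : set (H' * H'))
  (A_LP : class_LP f k A) (A'_LP : class_LP f' k A')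
  (A_nonmax : ~ maximal_pi_symmetric f A)
  (A'_nonmax : ~ maximal_pi_symmetric f' A')
  (Hm Hp : set H) (Ga : set R[i]) (A_Ga : Gamma_set f k t0 Hm Hp A Ga)
  (Hm' Hp' : set H') (Ga' : set R[i])
  (A'_Ga : Gamma_set f' k t0 Hm' Hp' A' Ga')
  (A_simple : simple_LP f A Ga) (A'_simple : simple_LP f' A' Ga')
  (* the boundary triples *)
  (G0 : completeNormedModType R[i]) (ip : {dot G0 for Num.conj})
  (G0_hilbert : hilbert_ip ip) (sepG0 : separable G0)
  (G1 : set G0) (G1_subspace : linear_subspace G1) (G1_closed : closed G1)
  (GB : set ((H * H) * (G0 * G0))) (GB' : set ((H' * H') * (G0 * G0)))
  (GB_triple : D_boundary_triple f ip G1 A GB)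
  (GB'_triple : D_boundary_triple f' ip G1 A' GB') :
  exists r0 : R, forall r : R, r0 < r ->
    (forall l : R[i], r < complex.Im l ->
       weyl_family GB l = weyl_family GB' l) ->
    unitarily_equivalent f f' GB GB'.
Proof.
have hA := simple_LP_simple_symmetric A_LP.1 A_Ga A_simple.
have hA' := simple_LP_simple_symmetric A'_LP.1 A'_Ga A'_simple.
(* every positive height works, by continuation in the half-planes *)
exists 0 => r r0 weyl_eq; have {}r0 := ltW r0.
have weyl_eq' (l : R[i]) : r < `|Im l| -> weyl_family GB l = weyl_family GB' l.
  have [l0|l0] := leP 0 (Im l).
    by rewrite ger0_norm //; apply: weyl_eq.
  rewrite ltr0_norm // => rl; rewrite -[l]conjcK.
  apply: (weyl_family_conj_eq hA hA' G0_hilbert G1_subspace G1_closed GB_triple GB'_triple).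
    by rewrite ImJ oppr_eq0 lt_eqF.
  by apply: weyl_eq; rewrite ImJ.
have sbvC p : same_boundary_values GB' GB (sector r) (p.2, p.1) <->
    same_boundary_values GB GB' (sector r) p.
  by split=> -[l [m [? ? ?]]]; exists l, m.
have weyl_eqC (l : R[i]) : r < `|Im l| -> weyl_family GB' l = weyl_family GB l.
  by move=> /weyl_eq'.
have [|||U [U' [UK U'K [C hC] isoU U0]]] := @unitary_extension _ _ _ f f'
    (same_boundary_values GB GB' (sector r)) (ss_pontryagin hA) (ss_pontryagin hA').
- exact: (same_boundary_values_isometric hA hA' GB_triple GB'_triple).
- move=> z h; apply: (same_boundary_values_total hA G0_hilbert G1_subspace
    G1_closed GB_triple r0 weyl_eqC) => p hp.
  by apply: (h (p.2, p.1)); apply/sbvC; case: p hp.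
- move=> z; exact: (same_boundary_values_total hA' G0_hilbert G1_subspace
    G1_closed GB'_triple r0 weyl_eq').
have isoU' x y : f (U' x) (U' y) = f' x y by rewrite -isoU !U'K.
have forth := transport hA' G0_hilbert G1_subspace G1_closed GB_triple GB'_triple
  (sector_ample r0) isoU.
have back := transport hA G0_hilbert G1_subspace G1_closed GB'_triple GB_triple
  (sector_ample r0) isoU'.
exists U; split=> //.
- by exists U'.
- by exists C%:C%C => x; rewrite !normE -rmorphM lecR.
apply/seteqP; split=> [[[x y] l] h|_ [[[x y] l] h <-] /=].
  exists ((U' x, U' y), l); last by rewrite /= !U'K.
  apply: back h => {x y l} l x m sl hx.
  have [x' [hx' /(sbvC (x, x'))/U0 /= Ux]] := sector_lift r0 weyl_eqC sl hx.
  by exists x' => //; rewrite -Ux UK.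
apply: forth h => {x y l} l x' m sl hx'.
have [x [hx hxx']] := sector_lift r0 weyl_eq' sl hx'.
by exists x => //; rewrite (U0 _ hxx').
Qed.
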